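(* Let $\mathfrak{g}$ be a $5$-dimensional real Lie algebra admitting a Sasakian structure $(\Phi,\alpha,\xi,g)$, and let $\mathfrak{z}(\mathfrak{g})$ denote its center. Then: (i) if $\mathfrak{z}(\mathfrak{g})\neq 0$, then $\mathfrak{g}$ is solvable, $\dim\mathfrak{z}(\mathfrak{g})=1$, and the quotient $\mathfrak{g}/\mathfrak{z}(\mathfrak{g})$ carries an induced Kähler structure; (ii) if $\mathfrak{z}(\mathfrak{g})=0$, then $\mathfrak{g}$ is isomorphic to one of the following Lie algebras: the direct products $\mathfrak{sl}(2,\mathbb{R})\times\mathfrak{aff}(\mathbb{R})$, $\mathfrak{su}(2)\times\mathfrak{aff}(\mathbb{R})$, or the non-unimodular solvable Lie algebra $\mathfrak{g}_0\cong\mathbb{R}^2\ltimes\mathfrak{h}_3$ with basis $e_1,\dots,e_5$ and structure equations $$[e_1,e_3]=e_3,\quad [e_1,e_4]=\tfrac12 e_4,\quad [e_1,e_5]=\tfrac12 e_5,\quad [e_2,e_4]=e_5,\quad [e_2,e_5]=-e_4,\quad [e_4,e_5]=-e_3$$ (all other brackets of basis elements being zero up to skew-symmetry).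
   Context: All Lie algebras are real and finite-dimensional. For a $1$-form $\alpha\in\mathfrak{g}^*$, $\mathrm{d}\alpha(X,Y)=-\alpha([X,Y])$. A Sasakian structure on a $(2n+1)$-dimensional Lie algebra $\mathfrak{g}$ is a quadruple $(\Phi,\alpha,\xi,g)$ with $\Phi\in\mathrm{End}(\mathfrak{g})$, $\alpha\in\mathfrak{g}^*$, $\xi\in\mathfrak{g}$ and $g$ an inner product on $\mathfrak{g}$ such that for all $X,Y\in\mathfrak{g}$: $\alpha(\xi)=1$; $\Phi^2=-\mathrm{I}+\xi\otimes\alpha$; $g(\Phi X,\Phi Y)=g(X,Y)-\alpha(X)\alpha(Y)$; $2g(X,\Phi Y)=\mathrm{d}\alpha(X,Y)$; and $N_\Phi=-\mathrm{d}\alpha\otimes\xi$, where $N_\Phi(X,Y)=\Phi^2[X,Y]+[\Phi X,\Phi Y]-\Phi[\Phi X,Y]-\Phi[X,\Phi Y]$. A Kähler structure on a Lie algebra $\mathfrak{h}$ is a pair $(\Phi,g)$ consisting of $\Phi\in\mathrm{End}(\mathfrak{h})$ with $\Phi^2=-\mathrm{I}$ and $N_\Phi=0$, and an inner product $g$ with $g(\Phi X,\Phi Y)=g(X,Y)$, such that the $2$-form $\omega(X,Y)=g(X,\Phi Y)$ is closed. When $\mathfrak{z}(\mathfrak{g})=\mathbb{R}\xi$, the induced Kähler structure on $\mathfrak{g}/\mathfrak{z}(\mathfrak{g})$ is the one obtained by transporting the restrictions of $\Phi$ and $g$ to $\ker\alpha$ through the linear isomorphism $\ker\alpha\to\mathfrak{g}/\mathfrak{z}(\mathfrak{g})$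 given by projection. $\mathfrak{aff}(\mathbb{R})$ is the Lie algebra of the group of affine motions of $\mathbb{R}$, i.e. the non-abelian $2$-dimensional Lie algebra; $\mathfrak{h}_3$ is the real $3$-dimensional Heisenberg Lie algebra. *)

(* Defs.v *)
From HB Require Import structures.
From mathcomp Require Import all_boot all_order all_algebra.
From mathcomp Require Import generic_quotient ring_quotient.
From mathcomp Require Import reals.
From mathcomp Require Import complex.
From mathcomp Require Import ring.

Set Implicit Arguments.
Unset Strict Implicit.
Unset Printing Implicit Defensive.

Import Order.TTheory GRing.Theory Num.Theory.
Local Open Scope ring_scope.

Reserved Notation "[ 'lie' x , y ]" (at level 0, x, y at level 99,
  format "[ 'lie'  x ,  y ]").

HB.mixin Record Vector_isLieAlgebra (K : fieldType) (L : Type)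
  of Vector K L := {
  lie_bracket : L -> L -> L;
  lie_linearl : forall z, linear (fun x => lie_bracket x z);
  lie_linearr : forall z, linear (lie_bracket z);
  lie_alternating : forall x, lie_bracket x x = 0;
  lie_jacobi : forall x y z,
    lie_bracket x (lie_bracket y z) + lie_bracket y (lie_bracket z x)
      + lie_bracket z (lie_bracket x y) = 0
}.

#[short(type="lieAlgType")]
HB.structure Definition LieAlgebra (K : fieldType) :=
  { L of Vector_isLieAlgebra K L & Vector K L }.

Notation "[ 'lie' x , y ]" := (lie_bracket x y) : ring_scope.

Section LieTheory.
Variables (K : fieldType) (L : lieAlgType K).
Implicit Types (x y z : L) (U V : {vspace L}).

HB.instance Definition _ z :=
  GRing.isLinear.Build K L L _ (lie_bracket z) (@lie_linearr K L z).

Lemma lieDl x y z : [lie x + y, z] = [lie x, z] + [lie y, z].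
Proof. by have := lie_linearl z 1 x y; rewrite !scale1r. Qed.

Lemma lie0l z : [lie 0, z] = 0.
Proof. by apply: (addIr [lie 0, z]); rewrite -lieDl !add0r. Qed.

Lemma lieZl a x z : [lie a *: x, z] = a *: [lie x, z].
Proof. by have := lie_linearl z a x 0; rewrite lie0l !addr0. Qed.

Lemma lieNl x z : [lie - x, z] = - [lie x, z].
Proof. by rewrite -scaleN1r lieZl scaleN1r. Qed.

Lemma lieBl x y z : [lie x - y, z] = [lie x, z] - [lie y, z].
Proof. by rewrite lieDl lieNl. Qed.

Lemma lieDr z x y : [lie z, x + y] = [lie z, x] + [lie z, y].
Proof. exact: linearD. Qed.

Lemma lieZr a z x : [lie z, a *: x] = a *: [lie z, x].
Proof. exact: linearZ. Qed.

Lemma lieNr z x : [lie z, - x] = - [lie z, x].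
Proof. exact: linearN. Qed.

Lemma lieC x y : [lie x, y] = - [lie y, x].
Proof.
have := lie_alternating (x + y).
rewrite lieDl !lieDr !lie_alternating add0r addr0 => /eqP.
by rewrite addr_eq0 => /eqP.
Qed.

Definition lie_ad x : 'End(L) := linfun (lie_bracket x).

Lemma lie_adE x y : lie_ad x y = [lie x, y]. Proof. by rewrite lfunE. Qed.

Fact lie_ad_linear : linear lie_ad.
Proof. by move=> a x y; apply/lfunP => z; rewrite add_lfunE scale_lfunE !lie_adE lie_linearl. Qed.

HB.instance Definition _ := GRing.isLinear.Build K L 'End(L) _ lie_ad lie_ad_linear.

Definition lie_center : {vspace L} := lker (linfun lie_ad).

Lemma lie_centerP x : reflect (forall y, [lie x, y] = 0) (x \in lie_center).
Proof.
rewrite memv_ker lfunE /=; apply: (iffP eqP) => [h y | h].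
  by rewrite -lie_adE h lfunE.
by apply/lfunP => y; rewrite lie_adE h lfunE.
Qed.

(** By bilinearity, bracketing bases suffices to span [[U, V]]. *)
Definition lie_span U V : {vspace L} :=
  <<[seq [lie u, v] | u <- vbasis U, v <- vbasis V]>>%VS.

Lemma memv_lie_span U V u v : u \in U -> v \in V -> [lie u, v] \in lie_span U V.
Proof.
move=> /coord_vbasis -> /coord_vbasis ->.
rewrite linear_sum; apply: memv_suml => i _; rewrite linearZ memvZ //=.
rewrite [X in X \in _]lieC memvN linear_sum; apply: memv_suml => j _.
rewrite linearZ memvZ //= lieC memvN; apply: memv_span.
by apply: allpairs_f; apply: mem_nth; rewrite size_tuple.
Qed.

Definition lie_derived_series (k : nat) : {vspace L} :=
  iter k (fun U => lie_span U U) fullv.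

Definition lie_solvable : Prop := exists k, lie_derived_series k = 0%VS.

Definition lie_unimodular : Prop :=
  forall x, \tr (passmx.mxof (vbasis {:L}) (vbasis {:L}) (lie_ad x)) = 0.

End LieTheory.

Definition lie_hom (K : fieldType) (L1 L2 : lieAlgType K) (f : 'Hom(L1, L2)) :=
  forall x y, f [lie x, y] = [lie f x, f y].

Definition lie_isomorphic (K : fieldType) (L1 L2 : lieAlgType K) : Prop :=
  exists f : 'Hom(L1, L2), bijective f /\ lie_hom f.

Record lie_subalg (K : fieldType) (L : lieAlgType K) := LieSubalg {
  subalg_vspace :> {vspace L};
  subalg_closed : forall x y,
    x \in subalg_vspace -> y \in subalg_vspace -> [lie x, y] \in subalg_vspace }.

Definition sub_lie (K : fieldType) (L : lieAlgType K) (U : lie_subalg L) : Type :=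
  subvs_of U.

Section SubLie.
Variables (K : fieldType) (L : lieAlgType K) (U : lie_subalg L).

HB.instance Definition _ := Vector.on (sub_lie U).

Definition sub_bracket (x y : sub_lie U) : sub_lie U :=
  Subvs (subalg_closed (subvsP x) (subvsP y)).

Fact sub_bracket_linearl z : linear (fun x => sub_bracket x z).
Proof. by move=> a x y; apply: val_inj; rewrite /= lieDl lieZl. Qed.
Fact sub_bracket_linearr z : linear (sub_bracket z).
Proof. by move=> a x y; apply: val_inj; rewrite /= lieDr lieZr. Qed.
Fact sub_bracket_alternating x : sub_bracket x x = 0.
Proof. by apply: val_inj; rewrite /= lie_alternating. Qed.
Fact sub_bracket_jacobi x y z :
  sub_bracket x (sub_bracket y z) + sub_bracket y (sub_bracket z x)
    + sub_bracket z (sub_bracket x y) = 0.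
Proof. by apply: val_inj; rewrite /= lie_jacobi. Qed.

HB.instance Definition _ := Vector_isLieAlgebra.Build K (sub_lie U)
  sub_bracket_linearl sub_bracket_linearr sub_bracket_alternating
  sub_bracket_jacobi.
End SubLie.

Lemma vect_iso_transfer (K : fieldType) (V : lmodType K) (W : vectType K)
    (f : V -> W) :
  linear f -> bijective f -> Vector.axiom (\dim {:W}) V.
Proof.
move=> lf bf; exists (passmx.rVof (vbasis {:W}) \o f).
  by move=> a x y /=; rewrite lf passmx.rVof_linear.
apply: bij_comp => //; exists (passmx.vecof (vbasis {:W})).
  exact/passmx.rVofK/vbasisP.
exact/passmx.vecofK/vbasisP.
Qed.

Definition vquot (K : fieldType) (V : vectType K) (U : {vspace V}) : Type :=
  Quotient.quot (pred_of_vspace U).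

Section VQuot.
Local Open Scope quotient_scope.
Variables (K : fieldType) (V : vectType K) (U : {vspace V}).
Local Notation Q := (vquot U).

HB.instance Definition _ := GRing.Zmodule.on Q.
HB.instance Definition _ := Quotient.on Q.

Definition vpi (x : V) : Q := \pi_Q x.

Lemma vpiP x y : reflect (vpi x = vpi y) (x - y \in U).
Proof. by rewrite Quotient.idealrBE; apply: eqP. Qed.

Lemma vpi_repr q : vpi (repr q) = q. Proof. exact: reprK. Qed.

Lemma repr_vpi x : repr (vpi x) - x \in U.
Proof. by apply/vpiP; rewrite vpi_repr. Qed.

Lemma vpiD x y : vpi (x + y) = vpi x + vpi y.
Proof. by rewrite /vpi !piE. Qed.

Definition vquot_scale (a : K) (q : Q) : Q := vpi (a *: repr q).

Lemma vpi_scale a x : vquot_scale a (vpi x) = vpi (a *: x).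
Proof. by apply/vpiP; rewrite -scalerBr memvZ // repr_vpi. Qed.

Fact vquot_scaleA a b q : vquot_scale a (vquot_scale b q) = vquot_scale (a * b) q.
Proof. by rewrite -[q]vpi_repr !vpi_scale scalerA. Qed.
Fact vquot_scale1 : left_id 1 vquot_scale.
Proof. by move=> q; rewrite -[q]vpi_repr vpi_scale scale1r. Qed.
Fact vquot_scaleDr : right_distributive vquot_scale +%R.
Proof.
move=> a p q; rewrite -[p]vpi_repr -[q]vpi_repr.
by rewrite -vpiD !vpi_scale scalerDr vpiD.
Qed.
Fact vquot_scaleDl q : {morph vquot_scale^~ q : a b / a + b}.
Proof. by move=> a b; rewrite -[q]vpi_repr !vpi_scale scalerDl vpiD. Qed.

HB.instance Definition _ := GRing.Zmodule_isLmodule.Build K Q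
  vquot_scaleA vquot_scale1 vquot_scaleDr vquot_scaleDl.

Fact vpi_linear : linear vpi.
Proof. by move=> a x y; rewrite vpiD -vpi_scale. Qed.
HB.instance Definition _ := GRing.isLinear.Build K V Q _ vpi vpi_linear.

(** The class of [x] is sent to the component of [x] along [U] in a fixed
    complement of [U], namely the kernel of [projv U]. *)
Let W := lker (projv U).
Let vquot_proj (q : Q) : subvs_of W := vsproj W (repr q - projv U (repr q)).

Let vquot_projE x : vquot_proj (vpi x) = vsproj W (x - projv U x).
Proof.
rewrite /vquot_proj; congr vsproj.
have /projv_id := repr_vpi x; rewrite linearB /= => h.
by apply/eqP; rewrite subr_eq addrAC -addrA h addrC subrK.
Qed.

Fact vquot_vect_iso : Vector.axiom (\dim {: subvs_of W}) Q.
Proof.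
have subW x : x - projv U x \in W.
  by rewrite memv_ker linearB /= (projv_id (memv_proj U x)) subrr.
apply: (@vect_iso_transfer _ Q (subvs_of W) vquot_proj).
  move=> a p q; rewrite -[p]vpi_repr -[q]vpi_repr -vpi_linear !vquot_projE.
  rewrite -linearP; congr vsproj.
  by rewrite linearP /= scalerBr opprD addrACA.
exists (fun w => vpi (vsval w)) => [q | w].
  rewrite -[q]vpi_repr vquot_projE vsprojK // [LHS]/=.
  by apply/vpiP; rewrite addrAC subrr add0r memvN memv_proj.
have /eqP w0 : projv U (vsval w) == 0 by rewrite -memv_ker subvsP.
by rewrite vquot_projE w0 subr0 vsvalK.
Qed.

HB.instance Definition _ := Lmodule_hasFinDim.Build K Q vquot_vect_iso.
End VQuot.

Record lie_ideal (K : fieldType) (L : lieAlgType K) := LieIdeal {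
  ideal_vspace :> {vspace L};
  ideal_closed : forall x y, y \in ideal_vspace -> [lie x, y] \in ideal_vspace }.

Definition lie_quot (K : fieldType) (L : lieAlgType K) (I : lie_ideal L) : Type :=
  vquot I.

Section LieQuot.
Local Open Scope quotient_scope.
Variables (K : fieldType) (L : lieAlgType K) (I : lie_ideal L).

HB.instance Definition _ := Vector.on (lie_quot I).

Definition lie_quot_proj : 'Hom(L, lie_quot I) := linfun (@vpi K L I).

Definition lie_quot_bracket (p q : lie_quot I) : lie_quot I :=
  lie_quot_proj [lie repr (p : vquot I), repr (q : vquot I)].

Let vpi_repr (q : lie_quot I) : q = lie_quot_proj (repr (q : vquot I)).
Proof. by rewrite lfunE; apply/esym/vpi_repr. Qed.

Let lie_quot_bracketE x y :
  lie_quot_bracket (lie_quot_proj x) (lie_quot_proj y) = lie_quot_proj [lie x, y].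
Proof.
rewrite /lie_quot_bracket !lfunE; apply/vpiP.
set x' := repr _; set y' := repr _.
have -> : [lie x', y'] - [lie x, y] = [lie x', y' - y] - [lie y, x' - x].
  by rewrite -[- [lie y, _]]lieC lieBl lieDr lieNr addrA subrK.
by rewrite memvB // ideal_closed // repr_vpi.
Qed.

Fact lie_quot_linearl z : linear (fun x => lie_quot_bracket x z).
Proof.
move=> a x y; rewrite (vpi_repr x) (vpi_repr y) (vpi_repr z).
by rewrite -linearP !lie_quot_bracketE -linearP /= lieDl lieZl.
Qed.
Fact lie_quot_linearr z : linear (lie_quot_bracket z).
Proof.
move=> a x y; rewrite (vpi_repr x) (vpi_repr y) (vpi_repr z).
by rewrite -linearP !lie_quot_bracketE -linearP /= linearP.
Qed.
Fact lie_quot_alternating x : lie_quot_bracket x x = 0.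
Proof.
by rewrite (vpi_repr x) lie_quot_bracketE lie_alternating linear0.
Qed.
Fact lie_quot_jacobi x y z :
  lie_quot_bracket x (lie_quot_bracket y z)
    + lie_quot_bracket y (lie_quot_bracket z x)
    + lie_quot_bracket z (lie_quot_bracket x y) = 0.
Proof.
rewrite (vpi_repr x) (vpi_repr y) (vpi_repr z) !lie_quot_bracketE.
by rewrite -!linearD lie_jacobi linear0.
Qed.

HB.instance Definition _ := Vector_isLieAlgebra.Build K (lie_quot I)
  lie_quot_linearl lie_quot_linearr lie_quot_alternating lie_quot_jacobi.

Lemma lie_quot_proj_hom : lie_hom lie_quot_proj.
Proof. by move=> x y; rewrite -lie_quot_bracketE. Qed.

Lemma lie_quot_projP x y :
  reflect (lie_quot_proj x = lie_quot_proj y) (x - y \in I).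
Proof. by rewrite !lfunE; apply: vpiP. Qed.

End LieQuot.

Section CenterIdeal.
Variables (K : fieldType) (L : lieAlgType K).

Fact lie_center_closed (x y : L) :
  y \in lie_center L -> [lie x, y] \in lie_center L.
Proof. by move/lie_centerP => h; rewrite lieC h oppr0 mem0v. Qed.

Definition lie_center_ideal : lie_ideal L := LieIdeal lie_center_closed.

End CenterIdeal.

Section ProdLie.
Variables (K : fieldType) (L1 L2 : lieAlgType K).

Definition prod_bracket (x y : L1 * L2) : L1 * L2 :=
  ([lie x.1, y.1], [lie x.2, y.2]).

Fact prod_bracket_linearl z : linear (fun x => prod_bracket x z).
Proof. by move=> a x y; congr pair; rewrite /= lieDl lieZl. Qed.
Fact prod_bracket_linearr z : linear (prod_bracket z).
Proof. by move=> a x y; congr pair; rewrite /= lieDr lieZr. Qed.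
Fact prod_bracket_alternating x : prod_bracket x x = 0.
Proof. by congr pair; rewrite lie_alternating. Qed.
Fact prod_bracket_jacobi x y z :
  prod_bracket x (prod_bracket y z) + prod_bracket y (prod_bracket z x)
    + prod_bracket z (prod_bracket x y) = 0.
Proof. by congr pair; rewrite /= lie_jacobi. Qed.

HB.instance Definition _ := Vector_isLieAlgebra.Build K (L1 * L2)%type
  prod_bracket_linearl prod_bracket_linearr prod_bracket_alternating
  prod_bracket_jacobi.
End ProdLie.

Record lie_action (K : fieldType) (A H : lieAlgType K) := LieAction {
  action_hom :> 'Hom(A, 'End(H));
  action_lie : forall a b h,
    action_hom [lie a, b] h
    = action_hom a (action_hom b h) - action_hom b (action_hom a h);
  action_derivation : forall a h k,
    action_hom a [lie h, k] = [lie action_hom a h, k] + [lie h, action_hom a k] }.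

Definition semidirect (K : fieldType) (A H : lieAlgType K) (D : lie_action A H)
  : Type := (A * H)%type.

Section Semidirect.
Variables (K : fieldType) (A H : lieAlgType K) (D : lie_action A H).

HB.instance Definition _ := Vector.copy (semidirect D) (A * H)%type.

Definition semidirect_bracket (x y : semidirect D) : semidirect D :=
  ([lie x.1, y.1], [lie x.2, y.2] + D x.1 y.2 - D y.1 x.2).

Let eq_coord (u v : H) :
  (forall i, coord (vbasis {:H}) i u = coord (vbasis {:H}) i v) -> u = v.
Proof.
move=> h; rewrite (coord_vbasis (memvf u)) (coord_vbasis (memvf v)).
by apply: eq_bigr => i _; rewrite h.
Qed.

Fact semidirect_linearl z : linear (fun x => semidirect_bracket x z).
Proof.
move=> a x y; congr pair; rewrite /= ?lieDl ?lieZl //.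
rewrite !linearP /= add_lfunE scale_lfunE.
by apply: eq_coord => i; rewrite !(linearD, linearN, linearZ) /=; ring.
Qed.
Fact semidirect_linearr z : linear (semidirect_bracket z).
Proof.
move=> a x y; congr pair; rewrite /= ?lieDr ?lieZr //.
rewrite !linearP /= add_lfunE scale_lfunE.
by apply: eq_coord => i; rewrite !(linearD, linearN, linearZ) /=; ring.
Qed.
Fact semidirect_alternating x : semidirect_bracket x x = 0.
Proof. by congr pair; rewrite /= !lie_alternating // add0r subrr. Qed.
Fact semidirect_jacobi x y z :
  semidirect_bracket x (semidirect_bracket y z)
    + semidirect_bracket y (semidirect_bracket z x)
    + semidirect_bracket z (semidirect_bracket x y) = 0.
Proof.
case: x y z => [a h] [b k] [c l].
congr pair; rewrite /= ?lie_jacobi // !action_lie.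
rewrite !(lieDr, lieNr, linearD, linearN) /= !action_derivation.
rewrite [[lie D a k, l]]lieC [[lie D b l, h]]lieC [[lie D c h, k]]lieC.
rewrite -[RHS](lie_jacobi h k l).
by apply: eq_coord => i; rewrite !(linearD, linearN) /=; ring.
Qed.

HB.instance Definition _ := Vector_isLieAlgebra.Build K (semidirect D)
  semidirect_linearl semidirect_linearr semidirect_alternating
  semidirect_jacobi.
End Semidirect.

Definition abelian_lie (K : fieldType) (V : vectType K) : Type := V.

Section AbelianLie.
Variables (K : fieldType) (V : vectType K).
Local Notation L := (abelian_lie V).

HB.instance Definition _ := Vector.on L.

Let br (x y : L) : L := 0.
Fact abelian_linearl z : linear (fun x => br x z).
Proof. by move=> a x y; rewrite scaler0 addr0. Qed.
Fact abelian_linearr z : linear (br z).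
Proof. by move=> a x y; rewrite scaler0 addr0. Qed.
Fact abelian_alternating x : br x x = 0. Proof. by []. Qed.
Fact abelian_jacobi x y z : br x (br y z) + br y (br z x) + br z (br x y) = 0.
Proof. by rewrite !addr0. Qed.

HB.instance Definition _ := Vector_isLieAlgebra.Build K L
  abelian_linearl abelian_linearr abelian_alternating abelian_jacobi.
End AbelianLie.

Section MatrixLie.
Variables (K : fieldType) (n : nat).
Implicit Types A B C : 'M[K]_n.

Definition mx_bracket A B := A *m B - B *m A.

Fact mx_bracket_linearl C : linear (fun A => mx_bracket A C).
Proof.
move=> a A B; rewrite /mx_bracket mulmxDl mulmxDr -scalemxAl -scalemxAr.
by rewrite opprD addrACA scalerBr.
Qed.
Fact mx_bracket_linearr C : linear (mx_bracket C).
Proof.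
move=> a A B; rewrite /mx_bracket mulmxDl mulmxDr -scalemxAl -scalemxAr.
by rewrite opprD addrACA scalerBr.
Qed.
Fact mx_bracket_alternating A : mx_bracket A A = 0.
Proof. exact: subrr. Qed.
Fact mx_bracket_jacobi A B C :
  mx_bracket A (mx_bracket B C) + mx_bracket B (mx_bracket C A)
    + mx_bracket C (mx_bracket A B) = 0.
Proof.
rewrite /mx_bracket !(mulmxBl, mulmxBr) !mulmxA.
by apply/matrixP => i j; rewrite !mxE; ring.
Qed.

HB.instance Definition _ := Vector_isLieAlgebra.Build K 'M[K]_n
  mx_bracket_linearl mx_bracket_linearr mx_bracket_alternating
  mx_bracket_jacobi.

Lemma mx_bracketE A B : [lie A, B] = A *m B - B *m A. Proof. by []. Qed.
End MatrixLie.

Section Sl2.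
Variable K : fieldType.

Definition sl2_vspace : {vspace 'M[K]_2} :=
  lker (linfun (fun A : 'M[K]_2 => \tr A : K^o)).

Lemma memv_sl2 (A : 'M[K]_2) : (A \in sl2_vspace) = (\tr A == 0).
Proof. by rewrite memv_ker lfunE. Qed.

Fact sl2_closed (A B : 'M[K]_2) :
  A \in sl2_vspace -> B \in sl2_vspace -> [lie A, B] \in sl2_vspace.
Proof.
by move=> _ _; rewrite memv_sl2 mx_bracketE linearB /= mxtrace_mulC subrr.
Qed.

Definition sl2_subalg : lie_subalg 'M[K]_2 := LieSubalg sl2_closed.
Definition sl2 : lieAlgType K := sub_lie sl2_subalg.
End Sl2.

(** [aff(K)]: the affine map [x |-> a x + b] is the matrix [[a b; 0 1]] acting on
    [(x, 1)], so the Lie algebra consists of the matrices with zero last row. *)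
Section Aff.
Variable K : fieldType.

Definition aff_vspace : {vspace 'M[K]_2} :=
  lker (linfun (fun A : 'M[K]_2 => row ord_max A)).

Lemma memv_aff (A : 'M[K]_2) : (A \in aff_vspace) = (row ord_max A == 0).
Proof. by rewrite memv_ker lfunE. Qed.

Fact aff_closed (A B : 'M[K]_2) :
  A \in aff_vspace -> B \in aff_vspace -> [lie A, B] \in aff_vspace.
Proof.
rewrite !memv_aff mx_bracketE => /eqP rA /eqP rB.
by rewrite linearB /= !row_mul rA rB !mul0mx subrr.
Qed.

Definition aff_subalg : lie_subalg 'M[K]_2 := LieSubalg aff_closed.
Definition aff : lieAlgType K := sub_lie aff_subalg.
End Aff.

Section Heis3.
Variable K : fieldType.

Definition lower_part (A : 'M[K]_3) : 'M[K]_3 :=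
  \matrix_(i, j) (if (j <= i)%N then A i j else 0).

Fact lower_part_linear : linear lower_part.
Proof.
move=> a A B; apply/matrixP => i j; rewrite !mxE.
by case: ifP => //; rewrite mulr0 addr0.
Qed.
HB.instance Definition _ :=
  GRing.isLinear.Build K 'M[K]_3 'M[K]_3 _ lower_part lower_part_linear.

(** The strictly upper triangular matrices. *)
Definition heis3_vspace : {vspace 'M[K]_3} := lker (linfun lower_part).

Lemma memv_heis3 (A : 'M[K]_3) :
  reflect (forall i j : 'I_3, (j <= i)%N -> A i j = 0) (A \in heis3_vspace).
Proof.
rewrite memv_ker lfunE /=; apply: (iffP eqP) => [/matrixP h i j ji | h].
  by have := h i j; rewrite !mxE ji.
by apply/matrixP => i j; rewrite !mxE; case: ifP => // /h.
Qed.

Fact heis3_closed (A B : 'M[K]_3) :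
  A \in heis3_vspace -> B \in heis3_vspace -> [lie A, B] \in heis3_vspace.
Proof.
have mul0 (C D : 'M[K]_3) (i j : 'I_3) :
    C \in heis3_vspace -> D \in heis3_vspace -> (j <= i)%N -> (C *m D) i j = 0.
  move=> /memv_heis3 hC /memv_heis3 hD ji; rewrite mxE big1 // => k _.
  have [ki | ik] := leqP k i; first by rewrite hC // mul0r.
  by rewrite hD ?mulr0 // (leq_trans ji) // ltnW.
move=> hA hB; apply/memv_heis3 => i j ji.
by rewrite mx_bracketE mxE [X in _ + X]mxE !mul0 // subrr.
Qed.

Definition heis3_subalg : lie_subalg 'M[K]_3 := LieSubalg heis3_closed.
Definition heis3 : lieAlgType K := sub_lie heis3_subalg.
End Heis3.

(** [gl(n, C)] as a Lie algebra over the real field [R]. *)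
Definition glC (R : rcfType) (n : nat) : Type := 'M[R[i]]_n.

Section ComplexMatrixLie.
Local Open Scope complex_scope.
Variables (R : rcfType) (n : nat).
Local Notation L := (glC R n).

HB.instance Definition _ := GRing.Zmodule.copy L 'M[R[i]]_n.

Definition glC_scale (a : R) (A : L) : L := a%:C *: (A : 'M[R[i]]_n).

Fact glC_scaleA a b A : glC_scale a (glC_scale b A) = glC_scale (a * b) A.
Proof. by rewrite /glC_scale scalerA rmorphM. Qed.
Fact glC_scale1 : left_id 1 glC_scale.
Proof. by move=> A; rewrite /glC_scale rmorph1 scale1r. Qed.
Fact glC_scaleDr : right_distributive glC_scale +%R.
Proof. by move=> a A B; apply: scalerDr. Qed.
Fact glC_scaleDl A : {morph glC_scale^~ A : a b / a + b}.
Proof. by move=> a b; rewrite /glC_scale rmorphD scalerDl. Qed.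

HB.instance Definition _ := GRing.Zmodule_isLmodule.Build R L
  glC_scaleA glC_scale1 glC_scaleDr glC_scaleDl.

Lemma glC_scaleE (a : R) (A : L) :
  a *: A = a%:C *: (A : 'M[R[i]]_n) :> 'M[R[i]]_n.
Proof. by []. Qed.

Let glC_re_im (A : L) : 'M[R]_n * 'M[R]_n :=
  (map_mx (@complex.Re R) A, map_mx (@complex.Im R) A).

Fact glC_vect_iso : Vector.axiom (\dim {: ('M[R]_n * 'M[R]_n)%type}) L.
Proof.
apply: (@vect_iso_transfer _ L _ glC_re_im).
  move=> a A B; congr pair; apply/matrixP => i j; rewrite !mxE /=;
  by case: (A i j) (B i j) => [? ?] [? ?] /=; ring.
exists (fun P : 'M[R]_n * 'M[R]_n =>
  \matrix_(i, j) (P.1 i j +i* P.2 i j) : 'M[R[i]]_n) => [A | [A B]].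
  by apply/matrixP => i j; rewrite !mxE /=; case: (A i j).
by congr pair; apply/matrixP => i j; rewrite !mxE.
Qed.

HB.instance Definition _ := Lmodule_hasFinDim.Build R L glC_vect_iso.

Definition glC_bracket (A B : L) : L := (A : 'M[R[i]]_n) *m B - B *m A.

Fact glC_linearl C : linear (fun A => glC_bracket A C).
Proof. by move=> a A B; apply: (@mx_bracket_linearl R[i] n C a%:C). Qed.
Fact glC_linearr C : linear (glC_bracket C).
Proof. by move=> a A B; apply: (@mx_bracket_linearr R[i] n C a%:C). Qed.
Fact glC_alternating A : glC_bracket A A = 0.
Proof. exact: (@mx_bracket_alternating R[i]). Qed.
Fact glC_jacobi A B C :
  glC_bracket A (glC_bracket B C) + glC_bracket B (glC_bracket C A)
    + glC_bracket C (glC_bracket A B) = 0.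
Proof. exact: (@mx_bracket_jacobi R[i]). Qed.

HB.instance Definition _ := Vector_isLieAlgebra.Build R L
  glC_linearl glC_linearr glC_alternating glC_jacobi.

Lemma glC_bracketE (A B : L) : [lie A, B] = (A : 'M[R[i]]_n) *m B - B *m A.
Proof. by []. Qed.
End ComplexMatrixLie.

Section Su2.
Local Open Scope complex_scope.
Variable R : rcfType.
Local Notation L := (glC R 2).

Definition ctrmx (A : 'M[R[i]]_2) : 'M[R[i]]_2 := (map_mx (@conjc R) A)^T.

Definition herm_part (A : L) : L := (A : 'M[R[i]]_2) + ctrmx A.
(** The trace is stored in a scalar matrix because [R[i]] is not declared as a
    [vectType] over [R]. *)
Definition trace_part (A : L) : L := (\tr (A : 'M[R[i]]_2))%:M.

Fact herm_part_linear : linear herm_part.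
Proof.
have cZ (a : R) (A : 'M[R[i]]_2) : ctrmx (a%:C *: A) = a%:C *: ctrmx A.
  by apply/matrixP => i j; rewrite !mxE rmorphM /= oppr0.
move=> a A B; rewrite /herm_part glC_scaleE.
by rewrite {1}/ctrmx map_mxD linearD /= -!/(ctrmx _) cZ scalerDr addrACA.
Qed.
HB.instance Definition _ := GRing.isLinear.Build R L L _ herm_part herm_part_linear.

Fact trace_part_linear : linear trace_part.
Proof.
move=> a A B; rewrite /trace_part !glC_scaleE linearD linearZ /= raddfD /=.
by rewrite -scale_scalar_mx.
Qed.
HB.instance Definition _ :=
  GRing.isLinear.Build R L L _ trace_part trace_part_linear.

Definition su2_vspace : {vspace L} :=
  (lker (linfun herm_part) :&: lker (linfun trace_part))%VS.

Lemma memv_su2 (A : L) :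
  reflect ((A : 'M[R[i]]_2) + ctrmx A = 0 /\ \tr (A : 'M[R[i]]_2) = 0)
          (A \in su2_vspace).
Proof.
rewrite memv_cap !memv_ker !lfunE; apply: (iffP andP) => [[/eqP h /eqP t]|[h t]].
  split=> //; have /matrixP/(_ 0 0) := t.
  by rewrite !mxE eqxx mulr1n.
by split; apply/eqP => //; rewrite /= /trace_part t raddf0.
Qed.

Fact su2_closed (A B : L) :
  A \in su2_vspace -> B \in su2_vspace -> [lie A, B] \in su2_vspace.
Proof.
move=> /memv_su2 [hA tA] /memv_su2 [hB tB]; apply/memv_su2; split; last first.
  by rewrite glC_bracketE linearB /= mxtrace_mulC subrr.
move/eqP: hA; rewrite addrC addr_eq0 => /eqP hA.
move/eqP: hB; rewrite addrC addr_eq0 => /eqP hB.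
have cM (C D : 'M[R[i]]_2) : ctrmx (C *m D) = ctrmx D *m ctrmx C.
  by rewrite /ctrmx map_mxM trmx_mul.
have -> : ctrmx [lie A, B] = ctrmx (B : 'M[R[i]]_2) *m ctrmx A - ctrmx A *m ctrmx B.
  by rewrite glC_bracketE -!cM /ctrmx map_mxB linearB.
rewrite hA hB glC_bracketE !mulNmx !mulmxN !opprK.
by rewrite addrA subrK subrr.
Qed.

Definition su2_subalg : lie_subalg L := LieSubalg su2_closed.
Definition su2 : lieAlgType R := sub_lie su2_subalg.
End Su2.

Definition g0 (K : numFieldType) : Type := 'rV[K]_5.

Section G0.
Variable K : numFieldType.
Local Notation L := (g0 K).

HB.instance Definition _ := Vector.on L.

(** Indices are 1-based, as in [e_1, ..., e_5]. *)
Definition g0_basis (k : nat) : L := delta_mx 0 (inord k.-1).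
Local Notation e := g0_basis.

(** Only the brackets [[e_i, e_j]] with [i < j] are listed; [g0_bracket] extends
    them by bilinearity and skew-symmetry. *)
Definition g0_table (i j : nat) : L :=
  match i, j with
  | 1, 3 => e 3
  | 1, 4 => 2^-1 *: e 4
  | 1, 5 => 2^-1 *: e 5
  | 2, 4 => e 5
  | 2, 5 => - e 4
  | 4, 5 => - e 3
  | _, _ => 0
  end.

Definition g0_bracket (x y : L) : L :=
  \sum_(i < 5) \sum_(j < 5 | (i < j)%N)
    ((x : 'rV_5) 0 i * (y : 'rV_5) 0 j - (x : 'rV_5) 0 j * (y : 'rV_5) 0 i)
      *: g0_table i.+1 j.+1.

Fact g0_linearl z : linear (fun x => g0_bracket x z).
Proof.
move=> a x y; rewrite /g0_bracket scaler_sumr -big_split; apply: eq_bigr => i _.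
rewrite scaler_sumr -big_split; apply: eq_bigr => j _ /=.
by rewrite scalerA -scalerDl !mxE; congr (_ *: _); ring.
Qed.
Fact g0_linearr z : linear (g0_bracket z).
Proof.
move=> a x y; rewrite /g0_bracket scaler_sumr -big_split; apply: eq_bigr => i _.
rewrite scaler_sumr -big_split; apply: eq_bigr => j _ /=.
by rewrite scalerA -scalerDl !mxE; congr (_ *: _); ring.
Qed.
Fact g0_alternating x : g0_bracket x x = 0.
Proof.
rewrite /g0_bracket big1 // => i _; rewrite big1 // => j _.
by rewrite [X in X - _]mulrC subrr scale0r.
Qed.

Let o0 : 'I_5 := @Ordinal 5 0 isT. Let o1 : 'I_5 := @Ordinal 5 1 isT.
Let o2 : 'I_5 := @Ordinal 5 2 isT. Let o3 : 'I_5 := @Ordinal 5 3 isT.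
Let o4 : 'I_5 := @Ordinal 5 4 isT.

Let sum5 (V : zmodType) (F : 'I_5 -> V) :
  \sum_(i < 5) F i = F o0 + F o1 + F o2 + F o3 + F o4.
Proof.
rewrite !big_ord_recr big_ord0 /= add0r.
by congr (_ + _ + _ + _ + _); congr F; apply: val_inj.
Qed.

Let g0_bracketE (x y : 'rV[K]_5) : g0_bracket x y =
  \row_k [:: 0; 0;
    x 0 o0 * y 0 o2 - x 0 o2 * y 0 o0 - (x 0 o3 * y 0 o4 - x 0 o4 * y 0 o3);
    (x 0 o0 * y 0 o3 - x 0 o3 * y 0 o0) / 2
      - (x 0 o1 * y 0 o4 - x 0 o4 * y 0 o1);
    (x 0 o0 * y 0 o4 - x 0 o4 * y 0 o0) / 2
      + (x 0 o1 * y 0 o3 - x 0 o3 * y 0 o1)]`_k.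
Proof.
have -> : g0_bracket x y = \sum_(i < 5) \sum_(j < 5) (if (i < j)%N then
    (x 0 i * y 0 j - x 0 j * y 0 i) *: g0_table i.+1 j.+1 else 0).
  by apply: eq_bigr => i _; rewrite big_mkcond.
rewrite !sum5 /= ?scaler0 ?addr0 ?add0r.
apply/rowP => k; rewrite !mxE -!val_eqE /= !inordK //.
case: k => [[|[|[|[|[|//]]]]] kP] /=; ring.
Qed.

Fact g0_jacobi x y z :
  g0_bracket x (g0_bracket y z) + g0_bracket y (g0_bracket z x)
    + g0_bracket z (g0_bracket x y) = 0.
Proof.
rewrite !g0_bracketE; apply/rowP => k; rewrite !mxE /=.
by case: k => [[|[|[|[|[|//]]]]] kP] /=; field.
Qed.

HB.instance Definition _ := Vector_isLieAlgebra.Build K L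
  g0_linearl g0_linearr g0_alternating g0_jacobi.

Lemma g0_structure (i j : nat) :
  (0 < i < j)%N -> (j <= 5)%N -> [lie e i, e j] = g0_table i j.
Proof.
move=> /andP[i0 ij] j5; rewrite [LHS]g0_bracketE; apply/rowP => k.
case: i i0 ij => [//|[|[|[|[|i]]]]] _ //; case: j j5 => [//|[|[|[|[|[|j]]]]]] // _ _;
rewrite !mxE -!val_eqE /= ?inordK //;
by case: k => [[|[|[|[|[|//]]]]] kP] /=; field.
Qed.
End G0.

Section Metric.
Variables (R : realType) (L : lieAlgType R).
Implicit Types (Phi : 'End(L)) (alpha : 'Hom(L, R^o)) (xi x y z : L).
Implicit Types (g omega : L -> L -> R).

Definition inner_product g : Prop :=
  [/\ forall z, scalar (fun x => g x z),
      forall x y, g x y = g y x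
    & forall x, x != 0 -> 0 < g x x].

Definition lie_d1 alpha x y : R := - alpha [lie x, y].

Definition lie_closed2 omega : Prop := forall x y z,
  omega [lie x, y] z + omega [lie y, z] x + omega [lie z, x] y = 0.

Definition nijenhuis Phi x y : L :=
  Phi (Phi [lie x, y]) + [lie Phi x, Phi y]
    - Phi [lie Phi x, y] - Phi [lie x, Phi y].

Record sasakian Phi alpha xi g : Prop := Sasakian {
  sasakian_dim : odd (\dim {:L});
  sasakian_metric : inner_product g;
  sasakian_reeb : alpha xi = 1 :> R;
  sasakian_sqr : forall x, Phi (Phi x) = - x + (alpha x : R) *: xi;
  sasakian_compat : forall x y,
    g (Phi x) (Phi y) = g x y - (alpha x : R) * (alpha y : R);
  sasakian_contact : forall x y, 2 * g x (Phi y) = lie_d1 alpha x y;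
  sasakian_normal : forall x y,
    nijenhuis Phi x y = - (lie_d1 alpha x y *: xi) }.

Record kaehler Phi g : Prop := Kaehler {
  kaehler_sqr : forall x, Phi (Phi x) = - x;
  kaehler_integrable : forall x y, nijenhuis Phi x y = 0;
  kaehler_metric : inner_product g;
  kaehler_compat : forall x y, g (Phi x) (Phi y) = g x y;
  kaehler_closed : lie_closed2 (fun x y => g x (Phi y)) }.

End Metric.

Section Induced.
Variables (R : realType) (L : lieAlgType R).
Variables (Phi : 'End(L)) (alpha : 'Hom(L, R^o)) (xi : L) (g : L -> L -> R).
Local Notation Q := (lie_quot (lie_center_ideal L)).
Local Notation D := (subvs_of (lker alpha)).

Definition ker_incl : 'Hom(D, L) := linfun vsval.

Definition ker_to_quot : 'Hom(D, Q) :=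
  (lie_quot_proj (lie_center_ideal L) \o ker_incl)%VF.

(** This is the restriction of [Phi] only if [Phi] preserves [ker alpha]. *)
Definition ker_restr : 'End(D) :=
  linfun (fun x : D => vsproj (lker alpha) (Phi (vsval x))).

(** [(ker_to_quot^-1)%VF] is a two-sided inverse only if [ker_to_quot] is
    bijective. *)
Definition induced_Phi : 'End(Q) :=
  (ker_to_quot \o ker_restr \o ker_to_quot^-1)%VF.

Definition induced_metric (p q : Q) : R :=
  g (vsval ((ker_to_quot^-1)%VF p)) (vsval ((ker_to_quot^-1)%VF q)).

Definition has_induced_kaehler : Prop :=
  [/\ lie_center L = <[xi]>%VS,
      (Phi @: lker alpha <= lker alpha)%VS,
      bijective ker_to_quot
    & kaehler induced_Phi induced_metric].
End Induced.

(* Main.v *)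
From HB Require Import structures.
Require Import Defs.
From mathcomp Require Import all_boot all_order all_algebra.
From mathcomp Require Import reals.
From mathcomp Require Import complex.
From mathcomp Require Import ring lra.
Import Order.TTheory GRing.Theory Num.Theory.
Local Open Scope ring_scope.

Set Implicit Arguments.
Unset Strict Implicit.
Unset Printing Implicit Defensive.

(** On the complex plane [V = ker alpha] with complex structure [Phi], the map
    [ad xi] is complex linear and skew for the metric, and [alpha [x, y]] is
    [- 2 g x (Phi y)]; in particular the centre lies in the line of [xi].

    If the centre is not zero, it is this line, and the quotient by it is a
    four-dimensional Kaehler algebra, whose closed fundamental form is half of
    [d alpha].  Its solvability depends on the trace form of the adjoint
    representation.  If this form vanishes, then for every linear form [b] the
    [2]-form [d b] satisfies [d b /\ d b = 0] ([pfaffian_identity]) and is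
    orthogonal to the fundamental form ([unimodular_contraction]).  The wedge
    product has signature [(3, 3)], with the fundamental form in the self-dual
    part; hence [d b = 0] as soon as its two other self-dual components vanish,
    and the derived algebra of the quotient has dimension at most two
    ([derived_sub_of_unimodular]).  If the trace form does not vanish, its
    kernel is a three-dimensional ideal with a derivation of nonzero trace, and
    a perfect algebra of dimension three has none ([solvable_of_trace]).

    If the centre is zero, then [ad xi] is not zero; diagonalise it in a unitary
    frame [e], [f] of [V], with eigenvalues [l], [m]
    ([eigenframe_exists]).  If both were nonzero, comparing the weights of
    [ad xi] in the brackets of the two eigenplanes would give both [m^2 = 4 l^2]
    and [l^2 = 4 m^2] ([eigenvalues_resonant]).  So [l = 0] and [m] is not zero,
    the centraliser of [xi] acts on the plane of [f] by complex numbers, and the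
    Jacobi identity leaves one discrete parameter and the sign of [m]
    ([reeb_normal_form_exists]).  In one case the plane of [f] and [xi] span a
    copy of [su2] or [sl2], according to the sign of [m], that commutes with a
    copy of [aff]; in the other case the algebra is [g0]. *)

(** * Linear algebra *)

Section LinearAlgebra.
Variables (K : fieldType) (V : vectType K).
Implicit Types (u v w x : V) (U W : {vspace V}).

Lemma vbasis_coord_inj u v :
  (forall i, coord (vbasis {:V}) i u = coord (vbasis {:V}) i v) -> u = v.
Proof.
move=> h; rewrite (coord_vbasis (memvf u)) (coord_vbasis (memvf v)).
by apply: eq_bigr => i _; rewrite h.
Qed.

Lemma vbasis_coordD i u v :
  coord (vbasis {:V}) i (u + v) = coord (vbasis {:V}) i u + coord (vbasis {:V}) i v.
Proof. exact: linearD. Qed.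

Lemma vbasis_coordN i u :
  coord (vbasis {:V}) i (- u) = - coord (vbasis {:V}) i u.
Proof. exact: linearN. Qed.

Lemma vbasis_coordZ i a u :
  coord (vbasis {:V}) i (a *: u) = a * coord (vbasis {:V}) i u.
Proof. exact: linearZ. Qed.

Lemma vbasis_coord0 i : coord (vbasis {:V}) i 0 = 0.
Proof. exact: linear0. Qed.

Definition vbasis_coordE :=
  (vbasis_coordD, vbasis_coordN, vbasis_coordZ, vbasis_coord0).

Lemma span_pad n U : (\dim U <= n)%N ->
  exists X : n.-tuple V, U = <<X>>%VS.
Proof.
move=> le_n; pose s := vbasis U ++ nseq (n - \dim U) 0.
have sz : size s == n by rewrite size_cat size_tuple size_nseq subnKC.
exists (Tuple sz); rewrite /= span_cat (span_basis (vbasisP U)).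
suff -> : <<nseq (n - \dim U) (0%R : V)>>%VS = 0%VS by rewrite addv0.
by elim: (n - _)%N => [|m IH]; rewrite /= ?span_nil // span_cons IH addv0 // vspace1E.
Qed.

Lemma sub_span2 U : (\dim U <= 2)%N -> exists p q, U = <<[:: p; q]>>%VS.
Proof.
move=> /span_pad[X ->]; case/tupleP: X => p X; case/tupleP: X => q X.
by rewrite tuple0; exists p, q.
Qed.

Lemma memv_span2 p q x : x \in <<[:: p; q]>>%VS ->
  exists a b, x = a *: p + b *: q.
Proof.
rewrite span_cons span_seq1 => /memv_addP[_ /vlineP[a ->] [_ /vlineP[b ->] ->]].
by exists a, b.
Qed.

Lemma memv_separate W x : x \notin W ->
  exists2 f : V -> K, scalar f & (forall w, w \in W -> f w = 0) /\ f x != 0.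
Proof.
move=> xW; pose y := x - projv W x.
have y0 : y != 0.
  apply: contraNneq xW => /eqP; rewrite subr_eq0 => /eqP ->; exact: memv_proj.
have [i iy] : exists i, coord (vbasis {:V}) i y != 0.
  apply/existsP; apply: contraNT y0 => /existsPn h; apply/eqP.
  by apply: vbasis_coord_inj => i; rewrite linear0; apply/eqP/negPn/h.
exists (fun v => coord (vbasis {:V}) i (v - projv W v)).
  move=> a u v; rewrite linearP opprD addrACA -scalerBr.
  by rewrite [LHS]linearP.
by split=> // w wW; rewrite projv_id // subrr linear0.
Qed.

Lemma scalar_fD (b : V -> K) : scalar b -> forall u v, b (u + v) = b u + b v.
Proof. by move=> lb u v; have := lb 1 u v; rewrite scale1r mul1r. Qed.

Lemma scalar_fZ (b : V -> K) : scalar b -> forall a u, b (a *: u) = a * b u.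
Proof.
move=> lb a u; have b0 : b 0 = 0 by apply: (addIr (b 0)); rewrite -scalar_fD // !add0r.
by have := lb a u 0; rewrite b0 !addr0.
Qed.

Lemma scalar_f0 (b : V -> K) : scalar b -> b 0 = 0.
Proof. by move=> lb; have := scalar_fZ lb 0 0; rewrite scale0r mul0r. Qed.

Lemma scalar_fN (b : V -> K) : scalar b -> forall u, b (- u) = - b u.
Proof. by move=> lb u; rewrite -scaleN1r scalar_fZ // mulN1r. Qed.

(** The trace whose vanishing on all [lie_ad x] is [lie_unimodular]. *)
Definition ltrace (F : 'End(V)) : K :=
  \tr (passmx.mxof (vbasis {:V}) (vbasis {:V}) F).

Lemma ltrace_dual n (x : 'I_n -> V) (phi : 'I_n -> V -> K) (F : 'End(V)) :
  (forall j, scalar (phi j)) -> (forall v, v = \sum_j phi j v *: x j) ->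
  ltrace F = \sum_j phi j (F (x j)).
Proof.
move=> lphi dual; pose b := vbasis {:V}.
pose phiL j : {linear V -> K^o} := HB.pack (phi j) (GRing.isLinear.Build _ _ _ _ _ (lphi j)).
transitivity (\sum_(i < \dim {:V}) coord b i (F b`_i)).
  apply: eq_bigr => i _; rewrite !mxE /=.
  by rewrite passmx.vecof_delta.
transitivity (\sum_(i < \dim {:V}) \sum_j phi j (F b`_i) * coord b i (x j)).
  apply: eq_bigr => i _; rewrite {1}[F b`_i]dual linear_sum.
  by apply: eq_bigr => j _; rewrite linearZ.
rewrite exchange_big; apply: eq_bigr => j _ /=.
rewrite [x j in RHS](coord_vbasis (memvf (x j))) -/b linear_sum.
have -> z : phi j z = phiL j z by [].
rewrite linear_sum; apply: eq_bigr => i _.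
by rewrite linearZ linearZ /= mulrC.
Qed.

Lemma ltrace_scalar : scalar ltrace.
Proof. by move=> a F G; rewrite /ltrace passmx.mxof_linear linearP. Qed.

Lemma ltrace_comp F G : ltrace (F \o G)%VF = ltrace (G \o F)%VF.
Proof.
by rewrite /ltrace !(passmx.mxof_comp _ _ (vbasisP {:V})) mxtrace_mulC.
Qed.

End LinearAlgebra.

(** Identities between vectors are polynomial identities between coordinates. *)
Ltac vring := apply: vbasis_coord_inj => ?; rewrite !vbasis_coordE; ring.
Ltac vfield := apply: vbasis_coord_inj => ?; rewrite !vbasis_coordE; field.

(** * Solvability and isomorphism criteria *)

Section LieGeneralities.
Variables (K : fieldType) (L : lieAlgType K).
Implicit Types (x y z : L) (U W X : {vspace L}).

Lemma lie0r z : [lie z, 0] = 0.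
Proof. exact: linear0. Qed.

Definition lieE := (lieDl, lieDr, lieZl, lieZr, lieNl, lieNr, lie0l, lie0r,
  @lie_alternating K L).

(** The Jacobi identity in the form: [ad x] is a derivation. *)
Lemma lie_leibniz x y z : [lie x, [lie y, z]] = [lie [lie x, y], z] + [lie y, [lie x, z]].
Proof.
have := lie_jacobi x y z.
rewrite [[lie z, [lie x, y]]]lieC [[lie z, x]]lieC lieNr => h.
by rewrite -[RHS]addr0 -h; vring.
Qed.

Lemma lie_span_le U W X : (forall u v, u \in U -> v \in W -> [lie u, v] \in X) ->
  (lie_span U W <= X)%VS.
Proof.
move=> h; apply/span_subvP => _ /allpairsP[[u v] /= [uU vW ->]].
by apply: h; apply: vbasis_mem.
Qed.

Lemma lie_derived_series_mono k U : (lie_derived_series L k <= U)%VS ->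
  (lie_derived_series L k.+1 <= lie_span U U)%VS.
Proof.
move=> kU; apply: lie_span_le => u v uk vk.
by apply: memv_lie_span; apply: (subvP kU).
Qed.

(** On the span of a central [z] and of [p], [q], the only bracket left is
    [[p, q]], so two further steps of the derived series reach zero. *)
Lemma lie_solvable_central_plane z p q k : (forall x, [lie z, x] = 0) ->
  (lie_derived_series L k <= <<[:: z; p; q]>>)%VS -> lie_solvable L.
Proof.
move=> cz kU; exists k.+2; apply/eqP; rewrite -subv0.
have k1 : (lie_derived_series L k.+1 <= <[[lie p, q]]>)%VS.
  apply: subv_trans (lie_derived_series_mono kU) _; apply: lie_span_le => u v.
  have mem3 t : t \in <<[:: z; p; q]>>%VS -> exists a b c, t = a *: z + (b *: p + c *: q).
    rewrite span_cons => /memv_addP[_ /vlineP[a ->] [s /memv_span2[b [c ->]] ->]].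
    by exists a, b, c.
  move=> /mem3[a [b [c ->]]] /mem3[a' [b' [c' ->]]].
  apply/vlineP; exists (b * c' - c * b').
  have zc x : [lie x, z] = 0 by rewrite lieC cz oppr0.
  rewrite !lieE !cz !zc [[lie q, p]]lieC; vring.
apply: subv_trans (lie_derived_series_mono k1) _; apply: lie_span_le => u v.
by move=> /vlineP[a ->] /vlineP[b ->]; rewrite !lieE !scaler0 mem0v.
Qed.

Lemma lie_solvable_of_dim3 z W k : z != 0 ->
  (forall x, [lie z, x] = 0) -> z \in W -> (\dim W <= 3)%N ->
  (lie_derived_series L k <= W)%VS -> lie_solvable L.
Proof.
move=> z0 cz zW dW kW.
have [p [q pq]] : exists p q, (W :\: <[z]>)%VS = <<[:: p; q]>>%VS.
  apply: sub_span2; have := dimv_cap_compl W <[z]>.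
  have -> : (W :&: <[z]>)%VS = <[z]>%VS by apply/capv_idPr; rewrite -memvE.
  by rewrite dim_vline z0 => h; rewrite -ltnS -add1n h.
apply: (lie_solvable_central_plane (p := p) (q := q) (k := k) cz).
apply: subv_trans kW _; rewrite span_cons -pq -[X in (X <= _)%VS](addv_diff_cap W <[z]>%VS).
by rewrite addvC addvS // capvSr.
Qed.

Lemma ltrace_ad_bracket x y : ltrace (lie_ad [lie x, y]) = 0.
Proof.
have -> : lie_ad [lie x, y] = (lie_ad x \o lie_ad y)%VF - (lie_ad y \o lie_ad x)%VF.
  apply/lfunP => z; rewrite add_lfunE opp_lfunE !comp_lfunE !lie_adE.
  by rewrite lie_leibniz addrK.
by rewrite -[X in _ - X]scale1r -scaleNr addrC ltrace_scalar ltrace_comp mulN1r addNr.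
Qed.

End LieGeneralities.

Section FiveDimensional.
Variables (K : fieldType) (L M : lieAlgType K).

(** The functions [p1], ..., [p5] are coordinates on [M]: they identify it with
    the space of [5]-tuples, and [psi] is then an isomorphism from [M] to [L]. *)
Lemma lie_isomorphic_of_coords (x1 x2 x3 x4 x5 : L)
    (p1 p2 p3 p4 p5 : M -> K) (psi : M -> L) :
  \dim {:L} = 5%N ->
  (forall x, exists c : K * K * K * K * K,
     x = c.1.1.1.1 *: x1 + c.1.1.1.2 *: x2 + c.1.1.2 *: x3 + c.1.2 *: x4 + c.2 *: x5) ->
  linear psi ->
  (forall m, psi m = p1 m *: x1 + p2 m *: x2 + p3 m *: x3 + p4 m *: x4 + p5 m *: x5) ->
  (forall m, p1 m = 0 -> p2 m = 0 -> p3 m = 0 -> p4 m = 0 -> p5 m = 0 -> m = 0) ->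
  (forall c1 c2 c3 c4 c5, exists m,
     [/\ p1 m = c1, p2 m = c2, p3 m = c3, p4 m = c4 & p5 m = c5]) ->
  (forall m m', psi [lie m, m'] = [lie psi m, psi m']) ->
  lie_isomorphic L M.
Proof.
move=> dimL gen lpsi psiE inj surj hom.
pose psiL : {linear M -> L} := HB.pack psi (GRing.isLinear.Build _ _ _ _ _ lpsi).
pose X := [tuple x1; x2; x3; x4; x5].
have fullX : <<X>>%VS = fullv.
  apply/vspaceP => x; rewrite memvf; have [[[[[a b] c] d] e] /= ->] := gen x.
  by rewrite !memvD // memvZ // memv_span // !inE eqxx ?orbT.
have freeX : free X by rewrite /free fullX dimL.
have psi0 m : psi m = 0 -> m = 0.
  rewrite psiE => m0; move/freeP: freeX => /(_ (tnth [tuple p1 m; p2 m; p3 m; p4 m; p5 m])).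
  rewrite !big_ord_recl big_ord0 /= !(tnth_nth 0) /= addr0 !addrA => /(_ m0) h.
  by apply: inj; [have := h 0|have := h (inord 1)|have := h (inord 2)|
    have := h (inord 3)|have := h (inord 4)]; rewrite (tnth_nth 0) /= ?inordK.
pose f := linfun psiL.
have kerf : lker f == 0%VS.
  apply/eqP/vspaceP => m; rewrite memv_ker memv0 lfunE /=.
  by apply/eqP/eqP => [/psi0 //| ->]; exact: (linear0 psiL).
have imgf : limg f = fullv.
  apply/vspaceP => x; rewrite memvf; have [[[[[a b] c] d] e] /= ->] := gen x.
  have [m [<- <- <- <- <-]] := surj a b c d e.
  rewrite -psiE; have -> : psi m = f m by rewrite lfunE.
  by rewrite memv_img ?memvf.
have fK : cancel f (f^-1)%VF by exact: lker0_lfunK.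
have fVK : cancel (f^-1)%VF f by move=> x; apply: limg_lfunVK; rewrite imgf memvf.
exists (f^-1)%VF; split; first by exists f.
move=> x y; apply: (can_inj fK); rewrite fVK.
have E m : f m = psi m by rewrite lfunE.
by rewrite E hom -!E !fVK.
Qed.

End FiveDimensional.

(** * First consequences of the Sasakian axioms *)

Section SasakianAlgebra.
Variables (R : realType) (L : lieAlgType R).
Variables (Phi : 'End(L)) (alpha : 'Hom(L, R^o)) (xi : L) (g : L -> L -> R).
Hypothesis sasaki : sasakian Phi alpha xi g.
Implicit Types (x y z e f : L).

Local Notation al x := (alpha x : R).

Lemma alphaD x y : al (x + y) = al x + al y. Proof. exact: (linearD alpha). Qed.
Lemma alphaN x : al (- x) = - al x. Proof. exact: (linearN alpha). Qed.
Lemma alphaZ a x : al (a *: x) = a * al x. Proof. exact: (linearZZ alpha). Qed.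
Lemma alpha0 : al 0 = 0. Proof. exact: (linear0 alpha). Qed.

Let PhiD x y : Phi (x + y) = Phi x + Phi y. Proof. exact: (linearD _). Qed.
Let PhiN x : Phi (- x) = - Phi x. Proof. exact: (linearN _). Qed.
Let PhiZ a x : Phi (a *: x) = a *: Phi x. Proof. exact: linearZ. Qed.
Let Phi0 : Phi 0 = 0. Proof. exact: (linear0 _). Qed.

Lemma metricC x y : g x y = g y x.
Proof. by case: (sasakian_metric sasaki). Qed.

Lemma metricDl x y z : g (x + y) z = g x z + g y z.
Proof.
case: (sasakian_metric sasaki) => lin _ _.
by have := lin z 1 x y; rewrite scale1r mul1r.
Qed.

Lemma metric0l z : g 0 z = 0.
Proof. by apply: (addIr (g 0 z)); rewrite -metricDl !add0r. Qed.

Lemma metricZl a x z : g (a *: x) z = a * g x z.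
Proof.
case: (sasakian_metric sasaki) => lin _ _.
by have := lin z a x 0; rewrite metric0l !addr0.
Qed.

Lemma metricNl x z : g (- x) z = - g x z.
Proof. by rewrite -scaleN1r metricZl mulN1r. Qed.
Lemma metricDr z x y : g z (x + y) = g z x + g z y.
Proof. by rewrite !(metricC z) metricDl. Qed.
Lemma metricZr a z x : g z (a *: x) = a * g z x.
Proof. by rewrite !(metricC z) metricZl. Qed.
Lemma metricNr z x : g z (- x) = - g z x.
Proof. by rewrite !(metricC z) metricNl. Qed.
Lemma metric0r z : g z 0 = 0.
Proof. by rewrite metricC metric0l. Qed.

Definition metricE := (metricDl, metricDr, metricZl, metricZr, metricNl,
  metricNr, metric0l, metric0r).

Lemma metric_gt0 x : x != 0 -> 0 < g x x.
Proof. by case: (sasakian_metric sasaki) => _ _; apply. Qed.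

Lemma metric_eq0 x : g x x = 0 -> x = 0.
Proof. by move=> gx; apply/eqP/negPn/negP => /metric_gt0; rewrite gx ltxx. Qed.

Let Phi2 := sasakian_sqr sasaki.
Let gPP := sasakian_compat sasaki.
Let alxi := sasakian_reeb sasaki.

Let al_Phi_xi x : (al x) *: Phi xi = al (Phi x) *: xi.
Proof.
have := congr1 Phi (Phi2 x); rewrite Phi2 PhiD PhiN PhiZ.
by move/addrI/esym.
Qed.

(** Computing [Phi (Phi (Phi xi))] in two ways shows that [xi] is an eigenvector
    of [Phi], and [Phi (Phi xi) = 0] that its eigenvalue is zero. *)
Lemma Phi_xi : Phi xi = 0.
Proof.
have h := al_Phi_xi xi; rewrite alxi scale1r in h.
have := Phi2 xi; rewrite alxi scale1r addNr; move: (al (Phi xi)) h => c h.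
rewrite h PhiZ h scalerA => /eqP.
rewrite scaler_eq0 mulf_eq0 orbb => /orP[/eqP -> | /eqP ->]; first by rewrite scale0r.
by rewrite scaler0.
Qed.

Lemma reeb_neq0 : xi != 0.
Proof. by apply/eqP => x0; move: alxi; rewrite x0 alpha0 => /esym/eqP; rewrite oner_eq0. Qed.

Lemma alpha_Phi x : al (Phi x) = 0.
Proof.
have := al_Phi_xi x; rewrite Phi_xi scaler0 => /esym/eqP.
by rewrite scaler_eq0 (negPf reeb_neq0) orbF => /eqP.
Qed.

Lemma metric_xi x : g x xi = al x.
Proof.
have := gPP x xi; rewrite Phi_xi metric0r alxi mulr1 => /esym/eqP.
by rewrite subr_eq0 => /eqP.
Qed.

Lemma metric_xil x : g xi x = al x.
Proof. by rewrite metricC metric_xi. Qed.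

Lemma alpha_lie x y : al [lie x, y] = - (2 * g x (Phi y)).
Proof. by rewrite (sasakian_contact sasaki) /lie_d1 opprK. Qed.

Lemma metric_Phil x y : g (Phi x) y = - g x (Phi y).
Proof.
have := gPP x (Phi y); rewrite Phi2 alpha_Phi mulr0 subr0 metricDr metricNr metricZr.
by rewrite metric_xi alpha_Phi mulr0 addr0 => <-; rewrite opprK.
Qed.

Lemma alpha_lie_xi y : al [lie xi, y] = 0.
Proof. by rewrite alpha_lie metric_xil alpha_Phi mulr0 oppr0. Qed.

(** Normality for the pair [xi], [y]. *)
Lemma lie_xi_Phi y : [lie xi, Phi y] = Phi [lie xi, y].
Proof.
have := sasakian_normal sasaki xi y.
rewrite /nijenhuis /lie_d1 alpha_lie_xi Phi_xi !lie0l Phi0 subr0 addr0.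
rewrite oppr0 scale0r oppr0 => /eqP; rewrite subr_eq0 => /eqP /(congr1 Phi).
rewrite !Phi2 alpha_Phi alpha_lie_xi !scale0r !addr0.
by move/oppr_inj => ->.
Qed.

(** Applying [alpha o ad xi = 0] to a bracket shows that [ad xi] preserves
    [d alpha]; it also commutes with [Phi], hence it is skew for the metric. *)
Lemma lie_xi_skew x y : g [lie xi, x] y = - g x [lie xi, y].
Proof.
have inv u v : g [lie xi, u] (Phi v) = - g u (Phi [lie xi, v]).
  have := alpha_lie_xi [lie u, v]; rewrite lie_leibniz alphaD !alpha_lie => h.
  have -> : g [lie xi, u] (Phi v) = - g u (Phi [lie xi, v]) by lra.
  by [].
have dec : y = - Phi (Phi y) + al y *: xi by rewrite Phi2; vring.
rewrite [in LHS]dec metricDr metricNr metricZr metric_xi alpha_lie_xi mulr0 addr0.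
rewrite inv lie_xi_Phi Phi2 alpha_lie_xi scale0r addr0 metricNr.
by rewrite opprK.
Qed.

Lemma metric_lie_xi x : g [lie xi, x] x = 0.
Proof. by have := lie_xi_skew x x; rewrite (metricC x) => h; lra. Qed.

(** A central [z] is in the kernel of [d alpha], which is the line of [xi]. *)
Lemma center_sub_xi z : z \in lie_center L -> z = al z *: xi.
Proof.
move=> /lie_centerP cz; apply/eqP; rewrite -subr_eq0; apply/eqP/metric_eq0.
have := alpha_lie z (Phi z); rewrite cz alpha0 Phi2 !metricE !(metric_xi, metric_xil) alxi => h; lra.
Qed.

(** * Adapted frames and the eigenvalues of the Reeb vector *)

Record phi_frame e f : Prop := PhiFrame {
  frame_al_e : al e = 0; frame_al_f : al f = 0;
  frame_ee : g e e = 1; frame_ff : g f f = 1;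
  frame_ef : g e f = 0; frame_Pef : g (Phi e) f = 0 }.

Lemma metric_PhiPhi e f : al e = 0 -> g (Phi e) (Phi f) = g e f.
Proof. by move=> e0; rewrite gPP e0 mul0r subr0. Qed.

Lemma metric_Phi_self e : g (Phi e) e = 0.
Proof. by have := metric_Phil e e; rewrite (metricC e) => h; lra. Qed.

(** The Gram matrix of [xi, e, Phi e, f, Phi f]. *)
Lemma frame_gram e f : phi_frame e f ->
  ((g e e = 1) * (g f f = 1) * (g e f = 0) * (g f e = 0) *
  (g (Phi e) f = 0) * (g f (Phi e) = 0) * (g e (Phi f) = 0) * (g (Phi f) e = 0) *
  (g (Phi e) e = 0) * (g e (Phi e) = 0) * (g (Phi f) f = 0) * (g f (Phi f) = 0) *
  (g (Phi e) (Phi e) = 1) * (g (Phi f) (Phi f) = 1) *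
  (g (Phi e) (Phi f) = 0) * (g (Phi f) (Phi e) = 0))%type.
Proof.
case=> ae af ee ff ef Pef.
have fPe : g f (Phi e) = 0 by rewrite metricC.
have ePf : g e (Phi f) = 0 by have := metric_Phil e f; rewrite Pef => h; lra.
by do !split; rewrite ?(metricC f e) ?(metricC (Phi f) e) ?(metricC _ (Phi e))
  ?(metricC _ (Phi f)) ?metric_PhiPhi ?metric_Phi_self // ?(metricC _ (Phi e)) ?metric_Phi_self // metricC.
Qed.

Hypothesis dimL : \dim {:L} = 5%N.

(** The five vectors are orthonormal, hence a basis in dimension five. *)
Lemma frame_expand e f x : phi_frame e f ->
  x = al x *: xi + g x e *: e + g x (Phi e) *: Phi e + g x f *: f + g x (Phi f) *: Phi f.
Proof.
move=> fr; have G := frame_gram fr; case: (fr) => ae af _ _ _ _.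
pose X := [tuple xi; e; Phi e; f; Phi f].
have freeX : free X.
  apply/freeP => k; rewrite !big_ord_recl big_ord0 /= addr0 => h.
  have k0 := congr1 (g xi) h; have k1 := congr1 (g e) h.
  have k2 := congr1 (g (Phi e)) h; have k3 := congr1 (g f) h.
  have k4 := congr1 (g (Phi f)) h.
  rewrite !metricE !G !metric_xi !metric_xil ?alpha_Phi ?ae ?af ?alxi in k0 k1 k2 k3 k4.
  rewrite !(mulr0, mulr1, addr0, add0r) in k0 k1 k2 k3 k4.
  case=> [[|[|[|[|[|//]]]]] kP]; [rewrite -[RHS]k0|rewrite -[RHS]k1|rewrite -[RHS]k2|
    rewrite -[RHS]k3|rewrite -[RHS]k4]; congr k; exact: val_inj.
have fullX : <<X>>%VS = fullv.
  have /eqP dimX : \dim <<X>> == 5%N := freeX.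
  by apply/eqP; rewrite eqEdim subvf dimL dimX.
have : x \in <<X>>%VS by rewrite fullX memvf.
rewrite span_cons => /memv_addP[_ /vlineP[a ->] [y]].
rewrite span_cons => /memv_addP[_ /vlineP[b ->] [z]].
rewrite span_cons => /memv_addP[_ /vlineP[c ->] [t /memv_span2[d [d' ->]] ->]] -> ->.
rewrite !metricE !G !metric_xil !(alphaD, alphaZ) ?alpha_Phi ?ae ?af alxi.
by rewrite !(mulr0, mulr1, addr0, add0r) !addrA.
Qed.

Lemma normalize x : al x = 0 -> x != 0 ->
  exists2 r : R, r != 0 & al (r *: x) = 0 /\ g (r *: x) (r *: x) = 1.
Proof.
move=> ax /metric_gt0 gx; exists (Num.sqrt (g x x))^-1.
  by rewrite invr_neq0 // gt_eqF // sqrtr_gt0.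
split; first by rewrite alphaZ ax mulr0.
rewrite metricZl metricZr mulrA -invfM -expr2 sqr_sqrtr ?ltW // mulVf //.
by rewrite gt_eqF.
Qed.

Lemma frame_of_unit e : al e = 0 -> g e e = 1 -> exists f, phi_frame e f.
Proof.
move=> ae ee; pose U := <<[:: xi; e; Phi e]>>%VS.
have [w wU] : exists w, w \notin U.
  have /subvPn[w _ wU] : ~~ (fullv <= U)%VS; last by exists w.
  by apply/negP => /dimvS; rewrite dimL => h; have := leq_trans h (dim_span _).
pose v := w - (al w *: xi + g w e *: e + g w (Phi e) *: Phi e).
have gPe : g (Phi e) (Phi e) = 1 by rewrite metric_PhiPhi.
have v0 : v != 0.
  apply: contraNneq wU => /eqP; rewrite subr_eq0 => /eqP ->.
  by rewrite !memvD // memvZ // memv_span // !inE eqxx ?orbT.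
have av : al v = 0.
  rewrite alphaD alphaN !alphaD !alphaZ alxi alpha_Phi ae; ring.
have [r _ [ar rr]] := normalize av v0; exists (r *: v).
have ePe : g e (Phi e) = 0 by rewrite metricC metric_Phi_self.
split=> //; rewrite metricZr !metricE !metric_xi ?alpha_Phi ?ae ?ee ?gPe ?metric_Phi_self.
  by rewrite ePe (metricC e w); ring.
by rewrite (metricC _ w); ring.
Qed.

Lemma frame_exists : exists e f, phi_frame e f.
Proof.
have /subvPn[w _ wU] : ~~ (fullv <= <[xi]>)%VS.
  by apply/negP => /dimvS; rewrite dimL dim_vline; case: (_ == _).
have v0 : w - al w *: xi != 0.
  apply: contraNneq wU => /eqP; rewrite subr_eq0 => /eqP ->.
  by rewrite memvZ // memv_line.
have av : al (w - al w *: xi) = 0 by rewrite alphaD alphaN alphaZ alxi mulr1 subrr.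
have [r _ [ar rr]] := normalize av v0.
by have [f fr] := frame_of_unit ar rr; exists (r *: (w - al w *: xi)), f.
Qed.

(** If [e] spans an eigenline, its orthogonal complement is one too, because
    [ad xi] is skew. *)
Lemma frame_eigen_complement e f l : phi_frame e f -> [lie xi, e] = l *: Phi e ->
  exists m, [lie xi, f] = m *: Phi f.
Proof.
move=> fr De; have G := frame_gram fr.
exists (g [lie xi, f] (Phi f)).
rewrite [LHS](frame_expand _ fr) alpha_lie_xi metric_lie_xi !lie_xi_skew lie_xi_Phi De.
rewrite PhiZ Phi2 (frame_al_e fr) scale0r addr0 !metricE !G; vring.
Qed.

(** [- Phi o ad xi] is a Hermitian endomorphism of the complex plane
    [(ker alpha, Phi)].  In the basis [e], [u], where [u] is [f] multiplied by a
    suitable complex number, its matrix is real with diagonal [a], [d] and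
    off-diagonal product [p^2 + q^2 >= 0]; so its characteristic polynomial has
    real roots, of which [l] is the larger one. *)
Lemma eigenvector_exists : exists x l, [/\ al x = 0, x != 0 & [lie xi, x] = l *: Phi x].
Proof.
have [e [f fr]] := frame_exists; have G := frame_gram fr.
have [ae af _ _ _ _] := fr.
pose p := g [lie xi, e] f; pose q := g [lie xi, e] (Phi f).
pose a := g [lie xi, e] (Phi e); pose d := g [lie xi, f] (Phi f).
have De : [lie xi, e] = a *: Phi e + p *: f + q *: Phi f.
  by rewrite [LHS](frame_expand _ fr) alpha_lie_xi metric_lie_xi -/p -/q -/a; vring.
have Df : [lie xi, f] = - p *: e + q *: Phi e + d *: Phi f.
  rewrite [LHS](frame_expand _ fr) alpha_lie_xi metric_lie_xi -/d !lie_xi_skew lie_xi_Phi De.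
  by rewrite !(PhiD, PhiZ) !Phi2 ae af !metricE !metric_xi ?af !G; vring.
have [r0 | rneq] := eqVneq (p ^+ 2 + q ^+ 2) 0.
  exists e, a; split=> //.
    by apply/eqP => e0; have := frame_ee fr; rewrite e0 metric0l => /eqP; rewrite eq_sym oner_eq0.
  have [p0 q0] : p = 0 /\ q = 0.
    by move/eqP: r0; rewrite paddr_eq0 ?sqr_ge0 // !sqrf_eq0 => /andP[/eqP -> /eqP ->].
  by rewrite De p0 q0; vring.
pose s := (a - d) ^+ 2 + 4 * (p ^+ 2 + q ^+ 2).
have s0 : 0 <= s by rewrite /s; have := sqr_ge0 p; have := sqr_ge0 q; have := sqr_ge0 (a - d); lra.
pose l := (a + d + Num.sqrt s) / 2.
have char_l : (l - d) * (l - a) = p ^+ 2 + q ^+ 2.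
  have : Num.sqrt s ^+ 2 = s by exact: sqr_sqrtr.
  rewrite /l; move: (Num.sqrt s) => t ht.
  have -> : ((a + d + t) / 2 - d) * ((a + d + t) / 2 - a) = (t ^+ 2 - (a - d) ^+ 2) / 4 by field.
  by rewrite ht /s; field.
(* chosen so that [ad xi] sends [e] to [a Phi e + Phi u] *)
pose u := q *: f - p *: Phi f.
exists ((l - d) *: e + u), l; split.
- by rewrite !(alphaD, alphaN, alphaZ) alpha_Phi ae af; ring.
- apply/eqP => x0; move/eqP: rneq; apply.
  have := congr1 (g u) x0; rewrite !metricE !G => h; rewrite -[RHS]h; ring.
transitivity (l *: Phi ((l - d) *: e + u)
  + (p ^+ 2 + q ^+ 2 - (l - d) * (l - a)) *: Phi e).
  rewrite !lieE lie_xi_Phi De Df !(PhiD, PhiZ, PhiN) !Phi2 ae af; vring.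
by rewrite char_l subrr scale0r addr0.
Qed.

Lemma eigenframe_exists : exists e f l m,
  [/\ phi_frame e f, [lie xi, e] = l *: Phi e & [lie xi, f] = m *: Phi f].
Proof.
have [x [l [ax x0 Dx]]] := eigenvector_exists.
have [r r0 [ar rr]] := normalize ax x0.
have [f fr] := frame_of_unit ar rr.
have De : [lie xi, r *: x] = l *: Phi (r *: x).
  by rewrite !lieE PhiZ Dx; vring.
by have [m Df] := frame_eigen_complement fr De; exists (r *: x), f, l, m.
Qed.

Lemma frame_sym e f : phi_frame e f -> phi_frame f e.
Proof. by move=> fr; have G := frame_gram fr; case: fr => *; split; rewrite // G. Qed.

End SasakianAlgebra.

Section Eigenframe.
Variables (R : realType) (L : lieAlgType R).
Variables (Phi : 'End(L)) (alpha : 'Hom(L, R^o)) (xi : L) (g : L -> L -> R).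
Hypothesis sasaki : sasakian Phi alpha xi g.
Hypothesis dimL : \dim {:L} = 5%N.
Implicit Types (x y z e f : L).

Local Notation al x := (alpha x : R).
Let PhiZ a x : Phi (a *: x) = a *: Phi x. Proof. exact: linearZ. Qed.
Let gE := metricE sasaki.
Let Phi2 := sasakian_sqr sasaki.
Let alP := alpha_Phi sasaki.

Lemma lie_xi_eigen_Phi e l : al e = 0 -> [lie xi, e] = l *: Phi e ->
  [lie xi, Phi e] = - l *: e.
Proof.
by move=> ae De; rewrite (lie_xi_Phi sasaki) De PhiZ Phi2 ae; vring.
Qed.

Lemma metric_lie_xi_eigen e l x : al e = 0 -> [lie xi, e] = l *: Phi e ->
  g [lie xi, x] e = - (l * g x (Phi e)).
Proof. by move=> ae De; rewrite (lie_xi_skew sasaki) De gE. Qed.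

Lemma metric_lie_xi_eigenP e l x : al e = 0 -> [lie xi, e] = l *: Phi e ->
  g [lie xi, x] (Phi e) = l * g x e.
Proof.
move=> ae De; rewrite (lie_xi_skew sasaki) (lie_xi_eigen_Phi ae De) gE; ring.
Qed.

Lemma alpha_lie_self e : al e = 0 -> al [lie e, Phi e] = 2 * g e e.
Proof. by move=> ae; rewrite (alpha_lie sasaki) Phi2 ae scale0r addr0 gE; ring. Qed.

Lemma lie_xi_self e l : al e = 0 -> [lie xi, e] = l *: Phi e ->
  [lie xi, [lie e, Phi e]] = 0.
Proof.
by move=> ae De; rewrite lie_leibniz (lie_xi_eigen_Phi ae De) De !lieE !scaler0 addr0.
Qed.

Variables (e f : L) (l m : R).
Hypotheses (fr : phi_frame Phi alpha g e f).
Hypotheses (De : [lie xi, e] = l *: Phi e) (Df : [lie xi, f] = m *: Phi f).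

Let ae := frame_al_e fr.
Let af := frame_al_f fr.
Let DPe := lie_xi_eigen_Phi ae De.
Let DPf := lie_xi_eigen_Phi af Df.
Let G := frame_gram sasaki fr.
Let expand x := frame_expand sasaki dimL x fr.

Lemma lie_xi_ker_e x : l != 0 -> [lie xi, x] = 0 -> g x e = 0 /\ g x (Phi e) = 0.
Proof.
move=> l0 Dx; have h1 := metric_lie_xi_eigen x ae De.
have h2 := metric_lie_xi_eigenP x ae De.
rewrite Dx !(metric0l sasaki) in h1 h2.
by split; apply: (mulfI l0); lra.
Qed.

Lemma weight_absent (s p q : R) :
  s ^+ 2 != l ^+ 2 -> l * p = s * q -> l * q = s * p -> p = 0.
Proof.
move=> ns h1 h2.
have h3 : (s ^+ 2 - l ^+ 2) * p = 0.
  have -> : (s ^+ 2 - l ^+ 2) * p = s * (s * p - l * q) + l * (s * q - l * p) by ring.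
  by rewrite h1 h2 !subrr !mulr0 addr0.
by move/eqP: h3; rewrite mulf_eq0 subr_eq0 (negPf ns) => /eqP.
Qed.

(** A bracket of the two eigenplanes has [ad xi]-weights [+-(l + m)] and
    [+-(l - m)], and its component in the plane of [e] has the weights [+-l];
    these differ when [m] and [m^2 - 4 l^2] are not zero. *)
Lemma mixed_brackets_sub : m != 0 -> m ^+ 2 != 4 * l ^+ 2 ->
  [/\ g [lie e, f] e = 0, g [lie e, f] (Phi e) = 0,
      g [lie e, Phi f] e = 0 & g [lie e, Phi f] (Phi e) = 0].
Proof.
move=> m0 nml.
have DA : [lie xi, [lie e, f]] = l *: [lie Phi e, f] + m *: [lie e, Phi f].
  by rewrite lie_leibniz De Df !lieE.
have DB : [lie xi, [lie e, Phi f]] = l *: [lie Phi e, Phi f] - m *: [lie e, f].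
  by rewrite lie_leibniz De DPf !lieE; vring.
have DC : [lie xi, [lie Phi e, f]] = m *: [lie Phi e, Phi f] - l *: [lie e, f].
  by rewrite lie_leibniz DPe Df !lieE; vring.
have DE : [lie xi, [lie Phi e, Phi f]] = - (l *: [lie e, Phi f] + m *: [lie Phi e, f]).
  by rewrite lie_leibniz DPe DPf !lieE; vring.
have e1 x := metric_lie_xi_eigen x ae De.
have e2 x := metric_lie_xi_eigenP x ae De.
have A1 := e1 [lie e, f]; have A2 := e2 [lie e, f].
have B1 := e1 [lie e, Phi f]; have B2 := e2 [lie e, Phi f].
have C1 := e1 [lie Phi e, f]; have C2 := e2 [lie Phi e, f].
have E1 := e1 [lie Phi e, Phi f]; have E2 := e2 [lie Phi e, Phi f].
rewrite ?DA ?DB ?DC ?DE !gE in A1 A2 B1 B2 C1 C2 E1 E2.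
move: A1 A2 B1 B2 C1 C2 E1 E2.
set a1 := g [lie e, f] e; set a2 := g [lie e, f] (Phi e).
set b1 := g [lie e, Phi f] e; set b2 := g [lie e, Phi f] (Phi e).
set c1 := g [lie Phi e, f] e; set c2 := g [lie Phi e, f] (Phi e).
set d1 := g [lie Phi e, Phi f] e; set d2 := g [lie Phi e, Phi f] (Phi e).
move=> A1 A2 B1 B2 C1 C2 E1 E2.
have nfac : (m - 2 * l) * (m + 2 * l) != 0.
  by rewrite -subr_sqr subr_eq0 exprMn; apply: contraNneq nml => ->; rewrite -natrX.
have /andP[n1 n2] : (m - 2 * l != 0) && (m + 2 * l != 0) by rewrite -negb_or -mulf_eq0.
have sum2 : (l + m) ^+ 2 != l ^+ 2.
  rewrite -subr_eq0; have -> : (l + m) ^+ 2 - l ^+ 2 = m * (m + 2 * l) by ring.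
  exact: mulf_neq0.
have dif2 : (m - l) ^+ 2 != l ^+ 2.
  rewrite -subr_eq0; have -> : (m - l) ^+ 2 - l ^+ 2 = m * (m - 2 * l) by ring.
  exact: mulf_neq0.
(* Real and imaginary parts of the brackets of weight vectors, of weight
   [l + m] for the first four equations and [m - l] for the last four. *)
have P1 : a1 - d1 = 0.
  by apply: (weight_absent (q := b2 + c2) sum2); lra.
have P2 : a2 - d2 = 0.
  by apply: (weight_absent (q := - (b1 + c1)) sum2); lra.
have Q1 : b1 + c1 = 0.
  by apply: (weight_absent (q := - (a2 - d2)) sum2); lra.
have Q2 : b2 + c2 = 0.
  by apply: (weight_absent (q := a1 - d1) sum2); lra.
have P1' : a1 + d1 = 0.
  by apply: (weight_absent (q := b2 - c2) dif2); lra.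
have P2' : a2 + d2 = 0.
  by apply: (weight_absent (q := - (b1 - c1)) dif2); lra.
have Q1' : b1 - c1 = 0.
  by apply: (weight_absent (q := - (a2 + d2)) dif2); lra.
have Q2' : b2 - c2 = 0.
  by apply: (weight_absent (q := a1 + d1) dif2); lra.
by split; lra.
Qed.

(** Otherwise the brackets of the two eigenplanes stay in the plane of [f], where
    all brackets are multiples of [xi].  The Jacobi identity for [f], [Phi f],
    [e] then puts [[2 xi, e] = 2 l Phi e] in the line of [xi]. *)
Lemma eigenvalues_resonant : l != 0 -> m != 0 -> m ^+ 2 = 4 * l ^+ 2.
Proof.
move=> l0 m0; apply/eqP/negPn/negP => nml.
have [a1 a2 b1 b2] := mixed_brackets_sub m0 nml.
have fPf : [lie f, Phi f] = 2 *: xi.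
  have D0 := lie_xi_self af Df.
  have [h1 h2] := lie_xi_ker_e l0 D0.
  have h3 : g [lie f, Phi f] f = 0.
    apply: (mulfI m0); rewrite mulr0 -(metric_lie_xi_eigenP _ af Df) D0.
    exact: (metric0l sasaki).
  have h4 : g [lie f, Phi f] (Phi f) = 0.
    apply: (mulfI m0); apply: oppr_inj; rewrite mulr0 -(metric_lie_xi_eigen _ af Df) D0.
    by rewrite (metric0l sasaki) oppr0.
  by rewrite [LHS]expand h1 h2 h3 h4 alpha_lie_self // G; vring.
have jac : 2 * l = 0; last first.
  by move/eqP: jac; rewrite mulf_eq0 (negPf l0) pnatr_eq0.
have J := congr1 (fun x => g x (Phi e)) (lie_leibniz f (Phi f) e).
have alpha_perp x y : g x (Phi y) = 0 -> al [lie x, y] = 0.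
  by rewrite (alpha_lie sasaki) => ->; rewrite mulr0 oppr0.
have eA : [lie f, e] = - (g [lie e, f] f *: f + g [lie e, f] (Phi f) *: Phi f).
  by rewrite lieC {1}[[lie e, f]]expand a1 a2 alpha_perp ?G //; vring.
have eB : [lie Phi f, e] = - (g [lie e, Phi f] f *: f + g [lie e, Phi f] (Phi f) *: Phi f).
  rewrite lieC {1}[[lie e, Phi f]]expand b1 b2 alpha_perp; first by vring.
  by rewrite Phi2 af !gE !G; ring.
rewrite eA eB fPf !lieE fPf [[lie Phi f, f]]lieC fPf De !gE !G !(metric_xil sasaki) alP in J.
by lra.
Qed.

End Eigenframe.

Section DegenerateReeb.
Variables (R : realType) (L : lieAlgType R).
Variables (Phi : 'End(L)) (alpha : 'Hom(L, R^o)) (xi : L) (g : L -> L -> R).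
Hypothesis sasaki : sasakian Phi alpha xi g.
Hypothesis dimL : \dim {:L} = 5%N.

(** The relation [m^2 = 4 l^2] holds with the two eigenvalues exchanged as
    well, which forces both to vanish. *)
Lemma reeb_not_invertible e f l m : phi_frame Phi alpha g e f ->
  [lie xi, e] = l *: Phi e -> [lie xi, f] = m *: Phi f -> (l == 0) || (m == 0).
Proof.
move=> fr De Df; apply/negPn/negP; rewrite negb_or => /andP[l0 m0].
have h1 := eigenvalues_resonant sasaki dimL fr De Df l0 m0.
have h2 := eigenvalues_resonant sasaki dimL (frame_sym sasaki fr) Df De m0 l0.
have : l ^+ 2 = 0 by lra.
by move/eqP; rewrite sqrf_eq0 (negPf l0).
Qed.

Lemma reeb_eigenframe : exists e f m,
  [/\ phi_frame Phi alpha g e f, [lie xi, e] = 0 & [lie xi, f] = m *: Phi f].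
Proof.
have [e [f [l [m [fr De Df]]]]] := eigenframe_exists sasaki dimL.
have /orP[/eqP z | /eqP z] := reeb_not_invertible fr De Df.
  by exists e, f, m; rewrite De z scale0r.
exists f, e, l; rewrite Df z scale0r; split=> //; exact: (frame_sym sasaki fr).
Qed.

End DegenerateReeb.

(** * Normal form for a nonzero Reeb rotation *)

(** The vectors [w] and [y] span a copy of [aff] that commutes with [xi], and
    [f], [h] span the plane rotated by [ad xi], on which [y] acts as the
    homothety [a].  The tuple of coefficients in [rnf_span] says that the five
    vectors generate [L]. *)
Record reeb_normal_form (R : realType) (L : lieAlgType R)
    (xi w y f h : L) (m a : R) : Prop := ReebNormalForm {
  rnf_span : forall x, exists c : R * R * R * R * R,
    x = c.1.1.1.1 *: xi + c.1.1.1.2 *: w + c.1.1.2 *: y + c.1.2 *: f + c.2 *: h;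
  rnf_xiw : [lie xi, w] = 0;
  rnf_xiy : [lie xi, y] = 0;
  rnf_xif : [lie xi, f] = m *: h;
  rnf_xih : [lie xi, h] = - m *: f;
  rnf_wy : [lie w, y] = w;
  rnf_wf : [lie w, f] = 0;
  rnf_wh : [lie w, h] = 0;
  rnf_yf : [lie y, f] = a *: f;
  rnf_yh : [lie y, h] = a *: h;
  rnf_fh : (a = 0 /\ [lie f, h] = 2 *: xi) \/ (a = - 2^-1 /\ [lie f, h] = w) }.

Section RankOneReeb.
Variables (R : realType) (L : lieAlgType R).
Variables (Phi : 'End(L)) (alpha : 'Hom(L, R^o)) (xi : L) (g : L -> L -> R).
Hypothesis sasaki : sasakian Phi alpha xi g.
Hypothesis dimL : \dim {:L} = 5%N.
Implicit Types (x y z u : L).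

Local Notation al x := (alpha x : R).
Let PhiD x y : Phi (x + y) = Phi x + Phi y. Proof. exact: linearD. Qed.
Let PhiZ a x : Phi (a *: x) = a *: Phi x. Proof. exact: linearZ. Qed.
Let gE := metricE sasaki.
Let Phi2 := sasakian_sqr sasaki.
Let alP := alpha_Phi sasaki.
Let alxi := sasakian_reeb sasaki.

Variables (e f : L) (m : R).
Hypotheses (fr : phi_frame Phi alpha g e f) (m_neq0 : m != 0).
Hypotheses (De : [lie xi, e] = 0) (Df : [lie xi, f] = m *: Phi f).

Let ae := frame_al_e fr.
Let af := frame_al_f fr.
Let DPe : [lie xi, Phi e] = 0.
Proof. by rewrite (lie_xi_Phi sasaki) De linear0. Qed.
Let DPf := lie_xi_eigen_Phi sasaki af Df.
Let G := frame_gram sasaki fr.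
Let expand x := frame_expand sasaki dimL x fr.

Let ker_D x : [lie xi, x] = 0 -> x = al x *: xi + g x e *: e + g x (Phi e) *: Phi e.
Proof.
move=> Dx; have [h1 h2] := lie_xi_ker_e sasaki (frame_sym sasaki fr) Df m_neq0 Dx.
by rewrite {1}[x]expand h1 h2; vring.
Qed.

(** On the rotated plane, an element of the kernel of [ad xi] acts by a complex
    number, because it commutes with [ad xi]. *)
Lemma ker_acts_complex u : [lie xi, u] = 0 -> g u f = 0 -> g u (Phi f) = 0 ->
  exists a b, [lie u, f] = a *: f + b *: Phi f /\ [lie u, Phi f] = a *: Phi f - b *: f.
Proof.
move=> Du uf uPf.
have DX : [lie xi, [lie u, f]] = m *: [lie u, Phi f] by rewrite lie_leibniz Du Df !lieE add0r.
have DY : [lie xi, [lie u, Phi f]] = - m *: [lie u, f] by rewrite lie_leibniz Du DPf !lieE add0r.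
have De0 : [lie xi, e] = 0 *: Phi e by rewrite scale0r.
have n1 := metric_lie_xi_eigen sasaki _ ae De0.
have n2 := metric_lie_xi_eigenP sasaki _ ae De0.
have X1 := n1 [lie u, f]; have X2 := n2 [lie u, f].
have Y1 := n1 [lie u, Phi f]; have Y2 := n2 [lie u, Phi f].
rewrite ?DX ?DY !gE !mul0r ?oppr0 in X1 X2 Y1 Y2.
have z (t : R) : m * t = 0 -> t = 0.
  by move/eqP; rewrite mulf_eq0 (negPf m_neq0) => /eqP.
have aX : al [lie u, f] = 0 by rewrite (alpha_lie sasaki) uPf mulr0 oppr0.
have a0 : g [lie u, f] e = 0 by apply: z; lra.
have a1 : g [lie u, f] (Phi e) = 0 by apply: z; lra.
exists (g [lie u, f] f), (g [lie u, f] (Phi f)).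
have Xe : [lie u, f] = g [lie u, f] f *: f + g [lie u, f] (Phi f) *: Phi f.
  by rewrite {1}[[lie u, f]]expand aX a0 a1; vring.
split=> //; apply: (scalerI m_neq0); rewrite -DX {1}Xe !lieE Df DPf; vring.
Qed.

(** Let [w = [e, Phi e] = 2 xi + k].  The Jacobi identity for [e], [Phi e], [f]
    shows that [w] kills the plane of [f], so [k] is not zero.  A multiple [y0]
    of [Phi k], corrected by a multiple of [xi] that cancels the rotation part
    of its action, gives [y].  The identities for [k], [f], [Phi f] and for
    [y0], [f], [Phi f] show that [[f, Phi f] = 2 xi + t k] with [t = - 2 a] and
    [t = t^2]. *)
Lemma reeb_normal_form_exists : exists w y a,
  reeb_normal_form xi w y f (Phi f) m a.
Proof.
have eX : [lie e, Phi e] = 2 *: xi + (g [lie e, Phi e] e *: e + g [lie e, Phi e] (Phi e) *: Phi e).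
  rewrite {1}[[lie e, Phi e]]ker_D; last by rewrite lie_leibniz De DPe !lieE addr0.
  by rewrite (alpha_lie_self sasaki ae) G; vring.
have fX : [lie f, Phi f] = 2 *: xi + (g [lie f, Phi f] e *: e + g [lie f, Phi f] (Phi e) *: Phi e).
  rewrite {1}[[lie f, Phi f]]ker_D ?(lie_xi_self sasaki af Df) //.
  by rewrite (alpha_lie_self sasaki af) G; vring.
move: eX fX; set k1 := g [lie e, Phi e] e; set k2 := g [lie e, Phi e] (Phi e).
set p1 := g [lie f, Phi f] e; set p2 := g [lie f, Phi f] (Phi e).
have [k kE] : exists k, k = k1 *: e + k2 *: Phi e by exists (k1 *: e + k2 *: Phi e).
have [w wE] : exists w, w = 2 *: xi + k by exists (2 *: xi + k).
rewrite -kE -wE => eX fX.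
have Dk : [lie xi, k] = 0 by rewrite kE !lieE De DPe !scaler0 addr0.
have [ce [de [ef ePf]]] : exists a b, [lie e, f] = a *: f + b *: Phi f /\
  [lie e, Phi f] = a *: Phi f - b *: f by apply: ker_acts_complex; rewrite ?G.
have [cp [dp [Pef PePf]]] : exists a b, [lie Phi e, f] = a *: f + b *: Phi f /\
  [lie Phi e, Phi f] = a *: Phi f - b *: f by apply: ker_acts_complex; rewrite ?G.
(* complex numbers commute, so the bracket of [e] and [Phi e] kills the plane *)
have wf : [lie w, f] = 0.
  have comm : [lie e, [lie Phi e, f]] = [lie Phi e, [lie e, f]].
    by rewrite Pef ef !lieE ef Pef ePf PePf; vring.
  have := lie_leibniz e (Phi e) f; rewrite eX comm => J.
  by apply: (addIr [lie Phi e, [lie e, f]]); rewrite -J add0r.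
have Dw : [lie xi, w] = 0 by rewrite wE !lieE Dk scaler0 addr0.
have wPf : [lie w, Phi f] = 0.
  apply: (scalerI m_neq0); rewrite scaler0 -lieZr -Df.
  by rewrite lie_leibniz wf lie0r addr0 [[lie w, xi]]lieC Dw oppr0 lie0l.
have kf : [lie k, f] = - (2 * m) *: Phi f.
  by move: wf; rewrite wE !lieE Df addrC => /eqP; rewrite addr_eq0 => /eqP ->; vring.
have kPf : [lie k, Phi f] = (2 * m) *: f.
  by move: wPf; rewrite wE !lieE DPf addrC => /eqP; rewrite addr_eq0 => /eqP ->; vring.
have gf0 : g f f = 1 by rewrite G.
have kk0 : k1 ^+ 2 + k2 ^+ 2 != 0.
  apply/eqP => kk; have [z1 z2] : k1 = 0 /\ k2 = 0.
    by move/eqP: kk; rewrite paddr_eq0 ?sqr_ge0 // !sqrf_eq0 => /andP[/eqP -> /eqP ->].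
  have := congr1 (fun x => g x (Phi f)) kf.
  rewrite kE z1 z2 !scale0r addr0 !lieE !gE G mulr1 => /esym/eqP.
  by rewrite oppr_eq0 mulf_eq0 (negPf m_neq0) pnatr_eq0.
set kk := k1 ^+ 2 + k2 ^+ 2 in kk0.
(* dividing by [kk] makes the bracket with [k], hence with [w], equal to [w] *)
have [y0 y0E] : exists y0, y0 = (k1 / kk) *: Phi e - (k2 / kk) *: e by eexists.
have Dy0 : [lie xi, y0] = 0 by rewrite y0E !lieE De DPe; vring.
have ky0 : [lie k, y0] = w.
  rewrite y0E kE !lieE [[lie Phi e, e]]lieC eX -[RHS]scale1r -(divff kk0) /kk; vfield.
  exact: kk0.
have [a [b [y0f y0Pf]]] : exists a b, [lie y0, f] = a *: f + b *: Phi f /\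
    [lie y0, Phi f] = a *: Phi f - b *: f.
  by apply: ker_acts_complex => //; rewrite y0E !gE !G; ring.
have [P PE] : exists P, P = p1 *: e + p2 *: Phi e by eexists.
rewrite -PE in fX.
have kP : k1 * p2 - k2 * p1 = 0.
  have J := lie_leibniz k f (Phi f).
  have : al [lie k, [lie f, Phi f]] = 0.
    by rewrite J kf kPf !lieE !scaler0 addr0 alpha0.
  rewrite fX lieDr lieZr [[lie k, xi]]lieC Dk oppr0 scaler0 add0r.
  have -> : [lie k, P] = (k1 * p2 - k2 * p1) *: [lie e, Phi e].
    by rewrite kE PE !lieE [[lie Phi e, e]]lieC; vring.
  by rewrite alphaZ (alpha_lie_self sasaki ae) G => h; lra.
pose t := (k1 * p1 + k2 * p2) / kk.
have Pt : P = t *: k.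
  have z1 : p1 = t * k1.
    have -> : t * k1 = p1 - k2 * (k1 * p2 - k2 * p1) / kk * (-1) by rewrite /t /kk; field; exact: kk0.
    by rewrite kP; ring.
  have z2 : p2 = t * k2.
    have -> : t * k2 = p2 - k1 * (k1 * p2 - k2 * p1) / kk by rewrite /t /kk; field; exact: kk0.
    by rewrite kP; ring.
  by rewrite PE z1 z2 kE; vring.
have ta : - t *: w = (2 * a) *: (2 *: xi + t *: k).
  rewrite -Pt -fX; have -> : - t *: w = [lie y0, [lie f, Phi f]].
    rewrite fX Pt lieDr !lieZr [[lie y0, xi]]lieC [[lie y0, k]]lieC Dy0 ky0; vring.
  by rewrite lie_leibniz y0f y0Pf !lieE; vring.
have ak : al k = 0 by rewrite kE !(alphaD, alphaZ) ae alP; ring.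
have t1 : t = - (2 * a).
  have := congr1 (fun x => al x) ta; rewrite wE !(alphaD, alphaZ) alxi ak => h; lra.
have t2 : t = t ^+ 2.
  have gk : g k k = kk by rewrite kE !gE !G /kk; ring.
  have := congr1 (g k) ta; rewrite wE !gE (metric_xi sasaki) ak gk => h.
  apply: (mulIf kk0); move: h; rewrite t1 expr2 => h; lra.
have [y yE] : exists y, y = y0 - (b / m) *: xi by eexists.
have xi0 x : [lie x, xi] = - [lie xi, x] by rewrite lieC.
exists w, y, a; split=> //.
- move=> x; exists (al x - 2 * g x k / kk + b / m * g x (Phi k), g x k / kk,
    g x (Phi k), g x f, g x (Phi f)) => /=.
  rewrite {1}[x]expand yE wE y0E kE !(PhiD, PhiZ) Phi2 ae !gE.
  rewrite (metric_xi sasaki) /kk; vfield.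
  by rewrite m_neq0 kk0.
- by rewrite yE !lieE Dy0; vring.
- by rewrite yE lieDr lieNr lieZr xi0 Dw wE lieDl lieZl Dy0 ky0 wE; vring.
- by rewrite yE lieBl lieZl Df y0f; vfield.
- by rewrite yE lieBl lieZl DPf y0Pf; vfield.
have : t * (t - 1) = 0 by move: t2; rewrite expr2 => h; lra.
move/eqP; rewrite mulf_eq0 subr_eq0 => /orP[/eqP t0 | /eqP t0].
  by left; split; [lra | rewrite fX Pt t0 scale0r addr0].
by right; split; [lra | rewrite fX Pt t0 scale1r].
Qed.
End RankOneReeb.

(** * The products with the affine algebra *)

Section ThreeDimensional.
Variables (R : realType) (S : lieAlgType R).

(** Coordinates [p], [q], [r] on [S] for a basis [X], [Y], [Z] with
    [[Y, Z] = X], [[Z, X] = Y] and [[X, Y] = eps Z]; this is [su2] for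
    [eps = 1] and [sl2] for [eps = -1]. *)
Record rotation_coords (eps : R) (p q r : S -> R) : Prop := RotationCoords {
  rot_linear : [/\ scalar p, scalar q & scalar r];
  rot_inj : forall A, p A = 0 -> q A = 0 -> r A = 0 -> A = 0;
  rot_surj : forall a b c, exists A, [/\ p A = a, q A = b & r A = c];
  rot_p : forall A B, p [lie A, B] = q A * r B - r A * q B;
  rot_q : forall A B, q [lie A, B] = r A * p B - p A * r B;
  rot_r : forall A B, r [lie A, B] = eps * (p A * q B - q A * p B) }.

End ThreeDimensional.

Section Aff.
Variable R : realType.
Local Notation a0 B := ((vsval (B : aff R) : 'M[R]_2) 0 0).
Local Notation a1 B := ((vsval (B : aff R) : 'M[R]_2) 0 1).

Lemma aff_row1 (B : aff R) j : (vsval B : 'M[R]_2) 1 j = 0.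
Proof.
have /eqP/rowP/(_ j) : row ord_max (vsval B) == 0 by rewrite -memv_aff subvsP.
by rewrite !mxE => <-; congr (vsval B _ _); apply: val_inj.
Qed.

Lemma aff_bracketE (B C : aff R) :
  a0 [lie B, C] = 0 /\ a1 [lie B, C] = a0 B * a1 C - a0 C * a1 B.
Proof.
have -> : vsval [lie B, C] = vsval B *m vsval C - vsval C *m vsval B by [].
rewrite !mxE !big_ord_recl !big_ord0 /=.
have -> : lift ord0 ord0 = 1 :> 'I_2 by apply: val_inj.
by rewrite !aff_row1; split; ring.
Qed.

Lemma aff_inj (B : aff R) : a0 B = 0 -> a1 B = 0 -> B = 0.
Proof.
move=> h0 h1; apply: val_inj; apply/matrixP => i j; rewrite /= !mxE.
case: (unliftP 0 i) => [i' ->|->].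
  have -> : lift 0 i' = 1 :> 'I_2 by apply: val_inj; rewrite /= ord1.
  exact: aff_row1.
case: (unliftP 0 j) => [j' ->|->] //.
by have -> : lift 0 j' = 1 :> 'I_2 by apply: val_inj; rewrite /= ord1.
Qed.

Lemma aff_surj (a b : R) : exists B : aff R, a0 B = a /\ a1 B = b.
Proof.
pose B : 'M[R]_2 := \matrix_(i, j) (if i == 0 then (if j == 0 then a else b) else 0).
have BU : B \in aff_vspace R by rewrite memv_aff; apply/eqP/rowP => j; rewrite !mxE.
by exists (Subvs BU); rewrite /= !mxE.
Qed.

End Aff.

Section Targets.
Variables (R : realType) (L : lieAlgType R) (xi w y f h : L) (m a : R).
Hypothesis dimL : \dim {:L} = 5%N.
Hypothesis nf : reeb_normal_form xi w y f h m a.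

Let lie_swap (x x' z : L) : [lie x, x'] = z -> [lie x', x] = - z.
Proof. by move=> <-; rewrite lieC. Qed.

Let xiw := rnf_xiw nf. Let wxi := lie_swap xiw.
Let xiy := rnf_xiy nf. Let yxi := lie_swap xiy.
Let xif := rnf_xif nf. Let fxi := lie_swap xif.
Let xih := rnf_xih nf. Let hxi := lie_swap xih.
Let wy := rnf_wy nf. Let yw := lie_swap wy.
Let wf := rnf_wf nf. Let fw := lie_swap wf.
Let wh := rnf_wh nf. Let hw := lie_swap wh.
Let yf := rnf_yf nf. Let fy := lie_swap yf.
Let yh := rnf_yh nf. Let hy := lie_swap yh.
Let brackets := (xiw, wxi, xiy, yxi, xif, fxi, xih, hxi, wy, yw, wf, fw, wh, hw,
  yf, fy, yh, hy).

(** With [s^2 = 2 m eps], the vectors [f / s], [h / s] and [xi / m] satisfy the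
    bracket relations of [S], while [- y] and [w] satisfy those of the matrix
    units that span [aff]. *)
Lemma isomorphic_to_product (S : lieAlgType R) (p q r : S -> R) (eps : R) :
  a = 0 -> [lie f, h] = 2 *: xi -> 0 < m * eps -> eps ^+ 2 = 1 ->
  rotation_coords eps p q r -> lie_isomorphic L (S * aff R)%type.
Proof.
move=> a0 fh meps eps2 [[lp lq lr] inj surj pE qE rE].
have hf := lie_swap fh.
pose s := Num.sqrt (2 * m * eps).
have s2 : s ^+ 2 = 2 * m * eps by rewrite sqr_sqrtr // -mulrA mulr_ge0 // ltW.
have s0 : s != 0 by rewrite gt_eqF // sqrtr_gt0 -mulrA mulr_gt0.
have m0 : m != 0 by apply: contraTneq meps => ->; rewrite mul0r ltxx.
pose p1 (M : (S * aff R)%type) := r M.1 / m.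
pose p2 (M : (S * aff R)%type) := (vsval M.2 : 'M[R]_2) 0 1.
pose p3 (M : (S * aff R)%type) := - (vsval M.2 : 'M[R]_2) 0 0.
pose p4 (M : (S * aff R)%type) := p M.1 / s.
pose p5 (M : (S * aff R)%type) := q M.1 / s.
apply: (lie_isomorphic_of_coords (p1 := p1) (p2 := p2) (p3 := p3) (p4 := p4) (p5 := p5)
  (psi := fun M => p1 M *: xi + p2 M *: w + p3 M *: y + p4 M *: f + p5 M *: h)
  dimL (rnf_span nf)) => //.
- move=> c M M'; rewrite /p1 /p2 /p3 /p4 /p5 /= lp lq lr !mxE; vring.
- move=> [A B]; rewrite /p1 /p2 /p3 /p4 /p5 /= => r0 b1 b0 pz qz.
  have z (t u : R) : u != 0 -> t / u = 0 -> t = 0.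
    by move=> u0 /eqP; rewrite mulf_eq0 invr_eq0 (negPf u0) orbF => /eqP.
  congr pair; first by apply: inj; [apply: z pz|apply: z qz|apply: z r0].
  by apply: aff_inj => //; apply/oppr_inj; rewrite b0 oppr0.
- move=> c1 c2 c3 c4 c5; have [A [A1 A2 A3]] := surj (s * c4) (s * c5) (m * c1).
  have [B [B0 B1]] := aff_surj (- c3) c2; exists (A, B).
  rewrite /p1 /p2 /p3 /p4 /p5 /= A1 A2 A3 B0 B1 opprK.
  by rewrite ![_ * _ / _]mulrAC !divff // !mul1r.
move=> [A B] [A' B']; rewrite /p1 /p2 /p3 /p4 /p5 /=.
have [-> ->] := aff_bracketE B B'; rewrite pE qE rE !lieE !brackets fh hf a0.
move: (p A) (q A) (r A) (p A') (q A') (r A') => pA qA rA pA' qA' rA'.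
move: (vsval B 0 0) (vsval B 0 1) (vsval B' 0 0) (vsval B' 0 1) => b0 b1 b0' b1'.
have -> : eps * (pA * qA' - qA * pA') / m = 2 * (pA * qA' - qA * pA') / s ^+ 2.
  rewrite s2; apply: (mulIf m0); rewrite mulfVK //.
  have e0 : eps != 0 by apply: contra_eq_neq eps2 => ->; rewrite expr0n eq_sym oner_eq0.
  rewrite -[LHS]mulr1; have -> : 1 = eps^-1 ^+ 2 by rewrite exprVn eps2 invr1.
  by field; rewrite m0 e0.
by vfield; rewrite m0 s0.
Qed.

End Targets.

Section Sl2Coords.
Variable R : realType.
Local Notation v A i j := ((vsval (A : sl2 R) : 'M[R]_2) i j).

Lemma sum_ord2 (V : nmodType) (F : 'I_2 -> V) : \sum_i F i = F 0 + F 1.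
Proof. by rewrite !big_ord_recl big_ord0 addr0; congr (_ + F _); apply: val_inj. Qed.

Lemma mx2P (T : Type) (A B : 'M[T]_2) : A 0 0 = B 0 0 -> A 0 1 = B 0 1 ->
  A 1 0 = B 1 0 -> A 1 1 = B 1 1 -> A = B.
Proof.
move=> h00 h01 h10 h11; apply/matrixP => i j.
have ord2 (k : 'I_2) : k = 0 \/ k = 1.
  by case: k => [[|[|//]] kP]; [left|right]; apply: val_inj.
by case: (ord2 i) => ->; case: (ord2 j) => ->.
Qed.

(** The basis consists of the halves of [diag (1, -1)], [[0 1; 1 0]] and
    [[0 -1; 1 0]]. *)
Lemma sl2_rotation_coords : rotation_coords (S := sl2 R) (-1)
  (fun A => 2 * v A 0 0) (fun A => v A 0 1 + v A 1 0) (fun A => v A 1 0 - v A 0 1).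
Proof.
have tr (A : sl2 R) : v A 1 1 = - v A 0 0.
  have /eqP : \tr (vsval A) == 0 by rewrite -memv_sl2 subvsP.
  by rewrite /mxtrace sum_ord2 addrC => /eqP; rewrite addr_eq0 => /eqP.
have brE (A B : sl2 R) i j : v [lie A, B] i j =
    v A i 0 * v B 0 j + v A i 1 * v B 1 j - (v B i 0 * v A 0 j + v B i 1 * v A 1 j).
  have -> : vsval [lie A, B] = vsval A *m vsval B - vsval B *m vsval A by [].
  by rewrite !mxE !sum_ord2.
split.
- by split=> c A B; rewrite /= !mxE; ring.
- move=> A h1 h2 h3; have A00 : v A 0 0 = 0 by lra.
  have A01 : v A 0 1 = 0 by lra.
  have A10 : v A 1 0 = 0 by lra.
  by apply: val_inj; apply: mx2P; rewrite /= !mxE ?tr ?A00 ?oppr0.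
- move=> x y z; pose A : 'M[R]_2 := \matrix_(i, j)
    (if i == 0 then (if j == 0 then x / 2 else (y - z) / 2)
     else (if j == 0 then (y + z) / 2 else - (x / 2))).
  have AU : A \in sl2_vspace R.
    by rewrite memv_sl2 /mxtrace sum_ord2 !mxE /= subrr.
  by exists (Subvs AU); rewrite /= !mxE /=; split; field.
- by move=> A B; rewrite !brE ?tr; ring.
- by move=> A B; rewrite !brE ?tr; ring.
- by move=> A B; rewrite !brE ?tr; ring.
Qed.

End Sl2Coords.

Section Su2Coords.
Variable R : realType.
Local Open Scope complex_scope.
Local Notation v A i j := ((vsval (A : su2 R) : 'M[R[i]]_2) i j).

(** The basis consists of the halves of [diag (i, -i)], [[0 1; -1 0]] and
    [[0 i; i 0]]. *)
Lemma su2_rotation_coords : rotation_coords (S := su2 R) 1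
  (fun A => 2 * complex.Im (v A 0 0)) (fun A => 2 * complex.Re (v A 0 1))
  (fun A => 2 * complex.Im (v A 0 1)).
Proof.
have ent (A : su2 R) : exists x y z : R, [/\ v A 0 0 = 0 +i* x, v A 0 1 = y +i* z,
    v A 1 0 = (- y) +i* z & v A 1 1 = 0 +i* (- x)].
  have /memv_su2[/matrixP H T] := subvsP A.
  move: (H 0 0) (H 0 1) T; rewrite /mxtrace sum_ord2 !mxE.
  case: (v A 0 0) (v A 0 1) (v A 1 0) (v A 1 1) => [a a'] [b b'] [c c'] [d d'] /=.
  move=> [h1 h2] [h3 h4] [h5 h6].
  by exists a', b, b'; split; congr Complex; lra.
have brE (A B : su2 R) i j : v [lie A, B] i j =
    v A i 0 * v B 0 j + v A i 1 * v B 1 j - (v B i 0 * v A 0 j + v B i 1 * v A 1 j).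
  have -> : vsval [lie A, B] = (vsval A : 'M[R[i]]_2) *m vsval B - (vsval B : 'M[R[i]]_2) *m vsval A by [].
  by rewrite !mxE !sum_ord2.
split.
- split=> c A B; rewrite /= !mxE.
  + by case: (v A 0 0) (v B 0 0) => [? ?] [? ?] /=; ring.
  + by case: (v A 0 1) (v B 0 1) => [? ?] [? ?] /=; ring.
  + by case: (v A 0 1) (v B 0 1) => [? ?] [? ?] /=; ring.
- move=> A; have [x [y [z [h00 h01 h10 h11]]]] := ent A.
  rewrite h00 h01 /= => hx hy hz; have x0 : x = 0 by lra.
  have y0 : y = 0 by lra. have z0 : z = 0 by lra.
  apply: val_inj; apply: (mx2P (A := vsval A : 'M[R[i]]_2)); rewrite ?h00 ?h01 ?h10 ?h11 /= !mxE;
  by rewrite ?x0 ?y0 ?z0 ?oppr0.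
- move=> x y z; pose A : 'M[R[i]]_2 := \matrix_(i, j)
    (if i == 0 then (if j == 0 then 0 +i* (x / 2) else (y / 2) +i* (z / 2))
     else (if j == 0 then (- (y / 2)) +i* (z / 2) else 0 +i* (- (x / 2)))).
  have AU : (A : glC R 2) \in su2_vspace R.
    apply/memv_su2; split.
      by apply: mx2P; rewrite !mxE /=; congr Complex; ring.
    by rewrite /mxtrace sum_ord2 !mxE /=; congr Complex; ring.
  by exists (Subvs AU); rewrite /= !mxE /=; split; field.
- move=> A B; rewrite !brE; have [x [y [z [e1 e2 e3 e4]]]] := ent A.
  by have [x' [y' [z' [f1 f2 f3 f4]]]] := ent B; rewrite ?(e1, e2, e3, e4) ?(f1, f2, f3, f4) /=; ring.
- move=> A B; rewrite !brE; have [x [y [z [e1 e2 e3 e4]]]] := ent A.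
  by have [x' [y' [z' [f1 f2 f3 f4]]]] := ent B; rewrite ?(e1, e2, e3, e4) ?(f1, f2, f3, f4) /=; ring.
- move=> A B; rewrite !brE; have [x [y [z [e1 e2 e3 e4]]]] := ent A.
  by have [x' [y' [z' [f1 f2 f3 f4]]]] := ent B; rewrite ?(e1, e2, e3, e4) ?(f1, f2, f3, f4) /=; ring.
Qed.

End Su2Coords.

(** * The algebra [g0] *)

Section G0.
Variable R : realType.
Local Notation M := (g0 R).
Implicit Types (x y : M).

Let o1 : 'I_5 := inord 1. Let o2 : 'I_5 := inord 2.
Let o3 : 'I_5 := inord 3. Let o4 : 'I_5 := inord 4.
Local Notation c x i := ((x : 'rV[R]_5) 0 i).

Lemma sum_ord5 (V : nmodType) (F : 'I_5 -> V) :
  \sum_i F i = F 0 + F o1 + F o2 + F o3 + F o4.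
Proof.
rewrite !big_ord_recr big_ord0 /= add0r.
by congr (_ + _ + _ + _ + _); congr F; apply: val_inj; rewrite /= ?inordK.
Qed.

Lemma ord5_ind (P : 'I_5 -> Prop) : P 0 -> P o1 -> P o2 -> P o3 -> P o4 -> forall i, P i.
Proof.
move=> P0 P1 P2 P3 P4 [[|[|[|[|[|//]]]]] iP];
  [move: P0|move: P1|move: P2|move: P3|move: P4];
  congr P; apply: val_inj; rewrite /= ?inordK //.
Qed.

Lemma g0_bracket_coords x y :
  [/\ c [lie x, y] 0 = 0, c [lie x, y] o1 = 0,
   c [lie x, y] o2 = c x 0 * c y o2 - c x o2 * c y 0 - (c x o3 * c y o4 - c x o4 * c y o3),
   c [lie x, y] o3 = (c x 0 * c y o3 - c x o3 * c y 0) / 2 - (c x o1 * c y o4 - c x o4 * c y o1)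
 & c [lie x, y] o4 = (c x 0 * c y o4 - c x o4 * c y 0) / 2 + (c x o1 * c y o3 - c x o3 * c y o1)].
Proof.
have -> : [lie x, y] = \sum_(i < 5) \sum_(j < 5) (if (i < j)%N then
    (c x i * c y j - c x j * c y i) *: g0_table R i.+1 j.+1 else 0).
  by apply: eq_bigr => i _; rewrite [LHS]big_mkcond.
rewrite !sum_ord5 /= !inordK //= ?scaler0 ?addr0 ?add0r.
by split; rewrite !mxE -!val_eqE /= !inordK //=; field.
Qed.

Lemma g0_expand x : x = c x 0 *: g0_basis R 1 + c x o1 *: g0_basis R 2
  + c x o2 *: g0_basis R 3 + c x o3 *: g0_basis R 4 + c x o4 *: g0_basis R 5.
Proof.
apply/rowP; apply: ord5_ind; rewrite !mxE -!val_eqE /= !inordK //=; ring.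
Qed.

Lemma g0_solvable : lie_solvable M.
Proof.
have D1 : (lie_derived_series M 1 <= <<[:: g0_basis R 3; g0_basis R 4; g0_basis R 5]>>)%VS.
  apply: lie_span_le => x y _ _; have [h0 h1 _ _ _] := g0_bracket_coords x y.
  rewrite [[lie x, y]]g0_expand h0 h1 !scale0r !add0r.
  by rewrite !memvD // memvZ // memv_span // !inE eqxx ?orbT.
have D2 : (lie_derived_series M 2 <= <[g0_basis R 3]>)%VS.
  apply: subv_trans (lie_derived_series_mono D1) _; apply: lie_span_le => x y.
  have mem3 z : z \in <<[:: g0_basis R 3; g0_basis R 4; g0_basis R 5]>>%VS -> c z 0 = 0 /\ c z o1 = 0.
    rewrite span_cons => /memv_addP[_ /vlineP[a ->] [_ /memv_span2[b [d ->]] ->]].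
    by rewrite !mxE -!val_eqE /= !inordK //=; split; ring.
  move=> /mem3[x0 x1] /mem3[y0 y1]; have [h0 h1 _ h3 h4] := g0_bracket_coords x y.
  rewrite [[lie x, y]]g0_expand h0 h1 h3 h4 x0 x1 y0 y1 !mul0r !mulr0 !subrr !mul0r subrr addr0.
  by rewrite !scale0r !add0r !addr0 memvZ ?memv_line.
exists 3%N; apply/eqP; rewrite -subv0.
apply: subv_trans (lie_derived_series_mono D2) _; apply: lie_span_le => x y.
by move=> /vlineP[a ->] /vlineP[b ->]; rewrite !lieE !scaler0 mem0v.
Qed.

(** The trace of [ad e_1] is [1 + 1/2 + 1/2]. *)
Lemma g0_not_unimodular : ~ lie_unimodular M.
Proof.
have lin (j : 'I_5) : scalar (fun v : M => c v j) by move=> k x y; rewrite /= !mxE.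
have dual (v : M) : v = \sum_(j < 5) c v j *: (delta_mx 0 j : M).
  by rewrite {1}[v : 'rV_5]row_sum_delta.
move=> /(_ (g0_basis R 1)); rewrite -/(ltrace _) (ltrace_dual _ lin dual) sum_ord5 /= !lie_adE.
have [-> _ _ _ _] := g0_bracket_coords (g0_basis R 1) (delta_mx 0 0 : 'rV_5).
have [_ -> _ _ _] := g0_bracket_coords (g0_basis R 1) (delta_mx 0 o1 : 'rV_5).
have [_ _ -> _ _] := g0_bracket_coords (g0_basis R 1) (delta_mx 0 o2 : 'rV_5).
have [_ _ _ -> _] := g0_bracket_coords (g0_basis R 1) (delta_mx 0 o3 : 'rV_5).
have [_ _ _ _ ->] := g0_bracket_coords (g0_basis R 1) (delta_mx 0 o4 : 'rV_5).
by rewrite !mxE -!val_eqE /= !inordK //= => h; lra.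
Qed.

Lemma dim_g0 : \dim {:M} = 5%N.
Proof. by rewrite dimvf. Qed.

(** The basis is [e_1 = - y], [e_2 = xi / m], [e_3 = - w], [e_4 = f], [e_5 = h]. *)
Lemma isomorphic_to_g0 (L : lieAlgType R) (xi w y f h : L) (m : R) :
  \dim {:L} = 5%N -> m != 0 -> [lie f, h] = w ->
  reeb_normal_form xi w y f h m (- 2^-1) -> lie_isomorphic L M.
Proof.
move=> dimL m0 fh nf.
have [sp xiw xiy xif xih wy wf wh yf yh _] := nf.
have swap (s t z : L) : [lie s, t] = z -> [lie t, s] = - z by move=> <-; rewrite lieC.
apply: (lie_isomorphic_of_coords (p1 := fun v : M => c v o1 / m) (p2 := fun v => - c v o2)
  (p3 := fun v => - c v 0) (p4 := fun v => c v o3) (p5 := fun v => c v o4)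
  (psi := fun v => (c v o1 / m) *: xi + (- c v o2) *: w + (- c v 0) *: y
                   + c v o3 *: f + c v o4 *: h) dimL sp) => //.
- by move=> k u v; rewrite !mxE; vring.
- move=> v /eqP; rewrite mulf_eq0 invr_eq0 (negPf m0) orbF => /eqP v1.
  move=> /eqP; rewrite oppr_eq0 => /eqP v2 /eqP; rewrite oppr_eq0 => /eqP v0 v3 v4.
  by apply/rowP; apply: ord5_ind; rewrite mxE.
- move=> c1 c2 c3 c4 c5; exists (\row_i [:: - c3; m * c1; - c2; c4; c5]`_i).
  by rewrite !mxE /= !inordK //= !opprK mulrAC divff // mul1r.
move=> u v; have [-> -> -> -> ->] := g0_bracket_coords u v.
rewrite !lieE xiw (swap _ _ _ xiw) xiy (swap _ _ _ xiy) xif (swap _ _ _ xif) xih (swap _ _ _ xih).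
rewrite wy (swap _ _ _ wy) wf (swap _ _ _ wf) wh (swap _ _ _ wh) yf (swap _ _ _ yf).
by rewrite yh (swap _ _ _ yh) fh (swap _ _ _ fh); vfield.
Qed.

End G0.

Section Semidirect.
Variable R : realType.
Local Notation A := (abelian_lie 'rV[R]_2).
Local Notation H := (heis3 R).
Local Notation ca a i := ((a : 'rV[R]_2) 0 i).
Definition heis3_coord (h : H) (i j : nat) : R :=
  (vsval h : 'M[R]_3) (inord i) (inord j).
Local Notation ch := heis3_coord.

Lemma heis3_coordD h k i j : ch (h + k) i j = ch h i j + ch k i j.
Proof. by rewrite /ch linearD mxE. Qed.
Lemma heis3_coordN h i j : ch (- h) i j = - ch h i j.
Proof. by rewrite /ch linearN mxE. Qed.
Lemma heis3_coordZ a h i j : ch (a *: h) i j = a * ch h i j.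
Proof. by rewrite /ch linearZ mxE. Qed.
Let chE := (heis3_coordD, heis3_coordN, heis3_coordZ).

Lemma heis3_inj (h k : H) : ch h 0 1 = ch k 0 1 -> ch h 1 2 = ch k 1 2 ->
  ch h 0 2 = ch k 0 2 -> h = k.
Proof.
move=> h01 h12 h02; apply: val_inj; apply/matrixP => s t.
have [ts|st] := leqP t s; first by rewrite !(memv_heis3 _ (subvsP _)).
rewrite -[s]inord_val -[t]inord_val.
by case: s st => [[|[|[|//]]] sP]; case: t => [[|[|[|//]]] tP].
Qed.

(** The action of [e_1] and [e_2] on [<e_3, e_4, e_5>]: the first coordinate of
    [a] acts by the weighted dilation, the second by the rotation of the plane
    of [E_01] and [E_12]. *)
Definition rotdil_mx (a : 'rV[R]_2) (h : 'M[R]_3) : 'M[R]_3 :=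
  \matrix_(i, j) match nat_of_ord i, nat_of_ord j with
    | 0, 1 => a 0 0 / 2 * h (inord 0) (inord 1) - a 0 1 * h (inord 1) (inord 2)
    | 1, 2 => a 0 0 / 2 * h (inord 1) (inord 2) + a 0 1 * h (inord 0) (inord 1)
    | 0, 2 => a 0 0 * h (inord 0) (inord 2)
    | _, _ => 0
    end.

Fact rotdil_heis3 a h : rotdil_mx a h \in heis3_vspace R.
Proof.
apply/memv_heis3 => i j; rewrite mxE.
by case: i j => [[|[|[|//]]] iP] [[|[|[|//]]] jP].
Qed.

Definition rotdil (a : A) (h : H) : H := Subvs (rotdil_heis3 a (vsval h)).

Lemma rotdilE a h : [/\ ch (rotdil a h) 0 1 = ca a 0 / 2 * ch h 0 1 - ca a 1 * ch h 1 2,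
  ch (rotdil a h) 1 2 = ca a 0 / 2 * ch h 1 2 + ca a 1 * ch h 0 1
  & ch (rotdil a h) 0 2 = ca a 0 * ch h 0 2].
Proof. by rewrite /ch /= !mxE /= !inordK. Qed.

Fact rotdil_linear a : linear (rotdil a).
Proof.
move=> k h h'; have [e1 e2 e3] := rotdilE a (k *: h + h').
have [f1 f2 f3] := rotdilE a h; have [g1 g2 g3] := rotdilE a h'.
by apply: heis3_inj; rewrite ?e1 ?e2 ?e3 !chE ?f1 ?f2 ?f3 ?g1 ?g2 ?g3; ring.
Qed.
HB.instance Definition _ a :=
  GRing.isLinear.Build R H H _ (rotdil a) (@rotdil_linear a).

Definition rotdil_end (a : A) : 'End(H) := linfun (rotdil a).

Fact rotdil_end_linear : linear rotdil_end.
Proof.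
move=> k a b; apply/lfunP => h; rewrite add_lfunE scale_lfunE !lfunE /=.
have [e1 e2 e3] := rotdilE (k *: a + b) h.
have [f1 f2 f3] := rotdilE a h; have [g1 g2 g3] := rotdilE b h.
by apply: heis3_inj; rewrite ?e1 ?e2 ?e3 !chE !mxE ?f1 ?f2 ?f3 ?g1 ?g2 ?g3; ring.
Qed.
HB.instance Definition _ :=
  GRing.isLinear.Build R A 'End(H) _ rotdil_end rotdil_end_linear.

Definition rotdil_hom : 'Hom(A, 'End(H)) := linfun rotdil_end.

Lemma rotdil_homE a h : rotdil_hom a h = rotdil a h.
Proof.
have -> : rotdil_hom a = rotdil_end a by rewrite /rotdil_hom lfunE.
by rewrite /rotdil_end lfunE.
Qed.

Lemma heis3_bracketE (h k : H) : [/\ ch [lie h, k] 0 1 = 0, ch [lie h, k] 1 2 = 0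
  & ch [lie h, k] 0 2 = ch h 0 1 * ch k 1 2 - ch k 0 1 * ch h 1 2].
Proof.
rewrite /ch.
have -> : vsval [lie h, k] = vsval h *m vsval k - vsval k *m vsval h by [].
have z (l : H) (i j : 'I_3) : (j <= i)%N -> vsval l i j = 0 by exact: (memv_heis3 _ (subvsP l)).
have sum3 (F : 'I_3 -> R) : \sum_i F i = F (inord 0) + F (inord 1) + F (inord 2).
  rewrite !big_ord_recr big_ord0 /= add0r.
  by congr (_ + _ + _); congr F; apply: val_inj; rewrite /= inordK.
rewrite /ch !mxE !sum3 !(z _ (inord 0) (inord 0)) ?(z _ (inord 1) (inord 1)) ?(z _ (inord 2) (inord 2))
  ?(z _ (inord 1) (inord 0)) ?(z _ (inord 2) (inord 0)) ?(z _ (inord 2) (inord 1)) ?inordK //.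
by split; ring.
Qed.

Fact rotdil_lie a b h : rotdil_hom [lie a, b] h
  = rotdil_hom a (rotdil_hom b h) - rotdil_hom b (rotdil_hom a h).
Proof.
rewrite !rotdil_homE; have [e1 e2 e3] := rotdilE [lie a, b] h.
have [a1 a2 a3] := rotdilE a (rotdil b h); have [b1 b2 b3] := rotdilE b (rotdil a h).
have [c1 c2 c3] := rotdilE a h; have [d1 d2 d3] := rotdilE b h.
have ab (i : 'I_2) : ca [lie a, b] i = 0 by rewrite mxE.
by apply: heis3_inj; rewrite ?e1 ?e2 ?e3 !chE !ab
  ?a1 ?a2 ?a3 ?b1 ?b2 ?b3 ?c1 ?c2 ?c3 ?d1 ?d2 ?d3; ring.
Qed.

Fact rotdil_derivation a h k : rotdil_hom a [lie h, k]
  = [lie rotdil_hom a h, k] + [lie h, rotdil_hom a k].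
Proof.
rewrite !rotdil_homE; have [e1 e2 e3] := rotdilE a [lie h, k].
have [h1 h2 h3] := rotdilE a h; have [k1 k2 k3] := rotdilE a k.
have [b1 b2 b3] := heis3_bracketE h k.
have [c1 c2 c3] := heis3_bracketE (rotdil a h) k.
have [d1 d2 d3] := heis3_bracketE h (rotdil a k).
apply: heis3_inj; rewrite ?e1 ?e2 ?e3 ?b1 ?b2 ?b3 !chE
  ?c1 ?c2 ?c3 ?d1 ?d2 ?d3 ?h1 ?h2 ?h3 ?k1 ?k2 ?k3; by field.
Qed.

Definition rotdil_action : lie_action A H := LieAction rotdil_lie rotdil_derivation.

(** The elements [e_4], [e_5], [e_3] correspond to the matrix units [E_01],
    [E_12] and [- E_02]. *)
Lemma g0_isomorphic_semidirect : lie_isomorphic (g0 R) (semidirect rotdil_action).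
Proof.
pose c (x : g0 R) k : R := (x : 'rV[R]_5) 0 (inord k).
pose p k (M : semidirect rotdil_action) : R :=
  [:: ca M.1 0; ca M.1 1; - ch M.2 0 2; ch M.2 0 1; ch M.2 1 2]`_k.
pose e := g0_basis R.
apply: (lie_isomorphic_of_coords (p1 := p 0%N) (p2 := p 1%N) (p3 := p 2%N)
  (p4 := p 3%N) (p5 := p 4%N) (psi := fun M => p 0%N M *: e 1%N + p 1%N M *: e 2%N
    + p 2%N M *: e 3%N + p 3%N M *: e 4%N + p 4%N M *: e 5%N) (dim_g0 R)) => //.
- by move=> x; eexists (_, _, _, _, _); exact: g0_expand.
- by move=> k M N; rewrite /p /= !chE !mxE; vring.
- move=> [a h] /= a0 a1 /eqP; rewrite oppr_eq0 => /eqP h02 h01 h12; congr pair.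
    by apply/rowP => i; rewrite mxE; case: i => [[|[|//]] iP]; [move: a0|move: a1];
      rewrite /p /= => <-; congr (a _ _); apply: val_inj.
  by apply: heis3_inj; rewrite ?h01 ?h12 ?h02 /ch mxE.
- move=> c1 c2 c3 c4 c5.
  pose a : 'rV[R]_2 := \row_i [:: c1; c2]`_i.
  pose h : 'M[R]_3 := \matrix_(i, j) match nat_of_ord i, nat_of_ord j with
    | 0, 1 => c4 | 1, 2 => c5 | 0, 2 => - c3 | _, _ => 0 end.
  have hU : h \in heis3_vspace R.
    by apply/memv_heis3 => -[[|[|[|//]]] iP] [[|[|[|//]]] jP]; rewrite mxE.
  exists ((a : A), (Subvs hU : H)); rewrite /p /ch /= !mxE /= !inordK //=.
  by rewrite opprK.
move=> [a h] [b k].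
have -> : [lie ((a, h) : semidirect rotdil_action), (b, k)]
   = ([lie a, b], [lie h, k] + rotdil a k - rotdil b h).
  by rewrite -!rotdil_homE.
have [h1 h2 h3] := heis3_bracketE h k.
have [a1 a2 a3] := rotdilE a k; have [b1 b2 b3] := rotdilE b h.
have ab (i : 'I_2) : ca [lie a, b] i = 0 by rewrite mxE.
have e13 : [lie e 1%N, e 3%N] = e 3%N by exact: g0_structure.
have e14 : [lie e 1%N, e 4%N] = 2^-1 *: e 4%N by exact: g0_structure.
have e15 : [lie e 1%N, e 5%N] = 2^-1 *: e 5%N by exact: g0_structure.
have e24 : [lie e 2%N, e 4%N] = e 5%N by exact: g0_structure.
have e25 : [lie e 2%N, e 5%N] = - e 4%N by exact: g0_structure.
have e45 : [lie e 4%N, e 5%N] = - e 3%N by exact: g0_structure.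
have e12 : [lie e 1%N, e 2%N] = 0 by exact: g0_structure.
have e23 : [lie e 2%N, e 3%N] = 0 by exact: g0_structure.
have e34 : [lie e 3%N, e 4%N] = 0 by exact: g0_structure.
have e35 : [lie e 3%N, e 5%N] = 0 by exact: g0_structure.
have swap (s t z : g0 R) : [lie s, t] = z -> [lie t, s] = - z by move=> <-; rewrite lieC.
rewrite /p /= !chE !ab h1 h2 h3 a1 a2 a3 b1 b2 b3 !lieE.
rewrite e13 e14 e15 e24 e25 e45 e12 e23 e34 e35.
rewrite (swap _ _ _ e13) (swap _ _ _ e14) (swap _ _ _ e15) (swap _ _ _ e24) (swap _ _ _ e25).
rewrite (swap _ _ _ e45) (swap _ _ _ e12) (swap _ _ _ e23) (swap _ _ _ e34) (swap _ _ _ e35).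
by vfield.
Qed.

End Semidirect.

(** * Solvability when the Reeb vector is central *)

(** Let [c i j k] be the structure constants of a four-dimensional algebra and
    [be] a linear form on it, so that [- b] is its differential.  The identity is
    [d (be /\ d be) = d be /\ d be]: the differential of a [3]-form is given by
    the traces of the adjoint representation, and [J] collects the Jacobi
    identities. *)
Section PfaffianIdentity.
Variables (R : comNzRingType) (c : nat -> nat -> nat -> R) (be : nat -> R).
Hypothesis anti : forall i j k, c i j k = - c j i k.
Hypothesis alt : forall i k, c i i k = 0.

Definition sum4 (F : nat -> R) := F 0%N + F 1%N + F 2%N + F 3%N.
Let b i j := sum4 (fun k => c i j k * be k).
Let J i j k := sum4 (fun l => c i j l * b l k + c j k l * b l i + c k i l * b l j).
Let tau i := sum4 (fun j => c i j j).
Let eta i j k := be i * b j k + be j * b k i + be k * b i j.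

Lemma pfaffian_identity :
  2 * (b 0%N 1%N * b 2%N 3%N - b 0%N 2%N * b 1%N 3%N + b 0%N 3%N * b 1%N 2%N) =
    (tau 0%N * eta 1%N 2%N 3%N + be 0%N * J 1%N 2%N 3%N)
  - (tau 1%N * eta 0%N 2%N 3%N + be 1%N * J 0%N 2%N 3%N)
  + (tau 2%N * eta 0%N 1%N 3%N + be 2%N * J 0%N 1%N 3%N)
  - (tau 3%N * eta 0%N 1%N 2%N + be 3%N * J 0%N 1%N 2%N).
Proof.
rewrite /eta /tau /J /b /sum4 !alt.
rewrite !(anti 1 0) !(anti 2 0) !(anti 3 0) !(anti 2 1) !(anti 3 1) !(anti 3 2).
ring.
Qed.

Lemma sum4_ext F F' : F =1 F' -> sum4 F = sum4 F'.
Proof. by move=> FF'; rewrite /sum4 !FF'. Qed.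

End PfaffianIdentity.

Section CentralReeb.
Variables (R : realType) (L : lieAlgType R).
Variables (Phi : 'End(L)) (alpha : 'Hom(L, R^o)) (xi : L) (g : L -> L -> R).
Hypothesis sasaki : sasakian Phi alpha xi g.
Hypothesis dimL : \dim {:L} = 5%N.
Hypothesis cxi : forall x, [lie xi, x] = 0.
Implicit Types (x y z u e f : L).

Local Notation al x := (alpha x : R).
Let gE := metricE sasaki.
Let Phi2 := sasakian_sqr sasaki.
Let alP := alpha_Phi sasaki.
Let alxi := sasakian_reeb sasaki.
Local Notation tau x := (ltrace (lie_ad x)).

Let liexi x : [lie x, xi] = 0. Proof. by rewrite lieC cxi oppr0. Qed.

Lemma tau_linear : scalar (fun x : L => tau x).
Proof. by move=> a x y; rewrite linearP ltrace_scalar. Qed.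

Section Frame.
Variables e f : L.
Hypothesis fr : phi_frame Phi alpha g e f.
Let G := frame_gram sasaki fr.
Let ae := frame_al_e fr.
Let af := frame_al_f fr.
Let expand x := frame_expand sasaki dimL x fr.

Lemma tau_frame x : tau x = g [lie x, e] e + g [lie x, Phi e] (Phi e)
  + g [lie x, f] f + g [lie x, Phi f] (Phi f).
Proof.
pose X := [tuple xi; e; Phi e; f; Phi f].
pose phi := [tuple (fun v => al v); (fun v => g v e); (fun v => g v (Phi e));
  (fun v => g v f); (fun v => g v (Phi f))].
rewrite (@ltrace_dual _ _ 5 (tnth X) (tnth phi)).
- rewrite !big_ord_recl big_ord0 !(tnth_nth 0) !(tnth_nth (fun=> 0)) /= !lie_adE liexi alpha0.
  by rewrite add0r addr0 !addrA.
- move=> j a u v; rewrite (tnth_nth (fun=> 0)).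
  by case: j => [[|[|[|[|[|//]]]]] jP]; rewrite /= ?(alphaD, alphaZ) ?gE.
- move=> v; rewrite !big_ord_recl big_ord0 !(tnth_nth 0) !(tnth_nth (fun=> 0)) /=.
  by rewrite {1}[v]expand addr0 !addrA.
Qed.

(** The fundamental [2]-form of the quotient by [xi] is closed, being
    proportional to [d alpha]. *)
Lemma metric_Phi_cocycle x y z :
  g [lie x, y] (Phi z) + g [lie y, z] (Phi x) + g [lie z, x] (Phi y) = 0.
Proof.
have := congr1 (fun x => al x) (lie_jacobi z x y).
rewrite !alphaD alpha0 [[lie z, [lie x, y]]]lieC [[lie x, [lie y, z]]]lieC [[lie y, [lie z, x]]]lieC.
by rewrite !(alphaN alpha) !(alpha_lie sasaki) => h; lra.
Qed.

Local Ltac generic_scalars :=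
  repeat match goal with |- context [g ?x ?y] => move: (g x y) => ? end.

(** Contracting the cocycle identity with the bivector dual to the fundamental
    form expresses the metric pairing of [[e, Phi e] + [f, Phi f]] with a vector
    of [ker alpha] as a trace of the adjoint representation. *)
Lemma unimodular_contraction (b : L -> R) : scalar b -> b xi = 0 ->
  (forall x, tau x = 0) -> b [lie e, Phi e] + b [lie f, Phi f] = 0.
Proof.
move=> lb bxi t0; have bE x : b x = g x e * b e + g x (Phi e) * b (Phi e)
    + g x f * b f + g x (Phi f) * b (Phi f).
  by rewrite {1}[x]expand !(scalar_fD lb) !(scalar_fZ lb) bxi; ring.
rewrite [b [lie e, _]]bE [b [lie f, _]]bE.
have := t0 e; have := t0 (Phi e); have := t0 f; have := t0 (Phi f).
rewrite !tau_frame !lie_alternating !(metric0l sasaki).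
rewrite [[lie f, e]]lieC [[lie f, Phi e]]lieC [[lie Phi f, e]]lieC [[lie Phi f, Phi e]]lieC.
rewrite [[lie Phi f, f]]lieC [[lie Phi e, e]]lieC !gE => h4 h3 h2 h1.
have := metric_Phi_cocycle e (Phi e) f; have := metric_Phi_cocycle e (Phi e) (Phi f).
have := metric_Phi_cocycle e f (Phi f); have := metric_Phi_cocycle (Phi e) f (Phi f).
rewrite [[lie f, e]]lieC [[lie Phi f, e]]lieC [[lie Phi f, Phi e]]lieC.
rewrite !Phi2 ae af !gE !(metric_xi sasaki) => k1 k2 k3 k4.
have z1 : g [lie e, Phi e] e + g [lie f, Phi f] e = 0 by move: h2 k1; generic_scalars; lra.
have z2 : g [lie e, Phi e] (Phi e) + g [lie f, Phi f] (Phi e) = 0 by move: h1 k2; generic_scalars; lra.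
have z3 : g [lie e, Phi e] f + g [lie f, Phi f] f = 0 by move: h4 k3; generic_scalars; lra.
have z4 : g [lie e, Phi e] (Phi f) + g [lie f, Phi f] (Phi f) = 0 by move: h3 k4; generic_scalars; lra.
transitivity ((g [lie e, Phi e] e + g [lie f, Phi f] e) * b e
  + (g [lie e, Phi e] (Phi e) + g [lie f, Phi f] (Phi e)) * b (Phi e)
  + (g [lie e, Phi e] f + g [lie f, Phi f] f) * b f
  + (g [lie e, Phi e] (Phi f) + g [lie f, Phi f] (Phi f)) * b (Phi f)).
  by generic_scalars; move: (b e) (b (Phi e)) (b f) (b (Phi f)) => *; ring.
by rewrite z1 z2 z3 z4 !mul0r !addr0.
Qed.

(** A linear form [b] that kills the three generators has, for [d b], vanishing
    components along a basis of the self-dual [2]-forms.  Then the identity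
    [d b /\ d b = 0] is a sum of three squares equal to zero, so [b] kills all
    brackets. *)
Lemma derived_sub_of_unimodular : (forall x, tau x = 0) ->
  (lie_derived_series L 1 <= <<[:: xi; ([lie e, f] - [lie Phi e, Phi f])%R;
                                  ([lie e, Phi f] + [lie Phi e, f])%R]>>)%VS.
Proof.
move=> t0; apply: lie_span_le => x y _ _; apply/negPn/negP => xyW.
have [b lb [bW bxy]] := memv_separate xyW.
have inW z : z \in [:: xi; [lie e, f] - [lie Phi e, Phi f]; [lie e, Phi f] + [lie Phi e, f]] -> b z = 0.
  by move=> zW; apply: bW; apply: memv_span.
have bxi : b xi = 0 by apply: inW; rewrite !inE eqxx.
have bw1 : b ([lie e, f] - [lie Phi e, Phi f]) = 0 by apply: inW; rewrite !inE eqxx !orbT.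
have bw2 : b ([lie e, Phi f] + [lie Phi e, f]) = 0 by apply: inW; rewrite !inE eqxx !orbT.
pose u i := nth xi [:: e; Phi e; f; Phi f] i.
have bE z : b z = sum4 (fun k => g z (u k) * b (u k)).
  by rewrite {1}[z]expand !(scalar_fD lb) !(scalar_fZ lb) bxi /sum4 /=; ring.
have brE z v : b [lie z, v] = sum4 (fun k => g z (u k) * b [lie u k, v]).
  by rewrite {1}[z]expand !lieE cxi !(scalar_fD lb) !(scalar_fZ lb) (scalar_f0 lb) /sum4 /=; ring.
have jac i j k : b [lie [lie u i, u j], u k] + b [lie [lie u j, u k], u i]
    + b [lie [lie u k, u i], u j] = 0.
  rewrite [[lie [lie u i, u j], _]]lieC [[lie [lie u j, u k], _]]lieC.
  rewrite [[lie [lie u k, u i], _]]lieC -!(scalar_fD lb) -!opprD.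
  by rewrite lie_jacobi oppr0 (scalar_f0 lb).
pose c i j k := g [lie u i, u j] (u k).
have anti i j k : c i j k = - c j i k by rewrite /c lieC gE.
have alt i k : c i i k = 0 by rewrite /c lie_alternating gE.
have := pfaffian_identity (fun k => b (u k)) anti alt.
have bcE i j : sum4 (fun k => c i j k * b (u k)) = b [lie u i, u j] by rewrite [RHS]bE.
have tE i : (i < 4)%N -> sum4 (fun j => c i j j) = 0.
  by move=> i4; rewrite -[RHS](t0 (u i)) tau_frame; case: i i4 => [|[|[|[|//]]]].
have JE i j k : sum4 (fun l => c i j l * sum4 (fun k0 => c l k k0 * b (u k0))
    + c j k l * sum4 (fun k0 => c l i k0 * b (u k0))
    + c k i l * sum4 (fun k0 => c l j k0 * b (u k0))) = 0.
  transitivity (sum4 (fun l => c i j l * b [lie u l, u k] + c j k l * b [lie u l, u i]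
      + c k i l * b [lie u l, u j])); first by apply: sum4_ext => l; rewrite !bcE.
  by rewrite -(jac i j k) !(brE [lie _, _]) /sum4 /c; ring.
rewrite !JE !tE // !bcE !mul0r !mulr0 !addr0 !subr0.
have b23 : b [lie f, Phi f] = - b [lie e, Phi e].
  by have := unimodular_contraction lb bxi t0; move/eqP; rewrite addrC addr_eq0 => /eqP.
have b13 : b [lie Phi e, Phi f] = b [lie e, f].
  by move/eqP: bw1; rewrite (scalar_fD lb) (scalar_fN lb) subr_eq0 => /eqP.
have b12 : b [lie Phi e, f] = - b [lie e, Phi f].
  by move/eqP: bw2; rewrite (scalar_fD lb) addrC addr_eq0 => /eqP.
rewrite /u /= b23 b13 b12 => pf.
have sq : b [lie e, Phi e] ^+ 2 + b [lie e, f] ^+ 2 + b [lie e, Phi f] ^+ 2 = 0.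
  by move: pf; move: (b _) (b _) (b _) => p q r h; lra.
have [z1 z2 z3] : [/\ b [lie e, Phi e] = 0, b [lie e, f] = 0 & b [lie e, Phi f] = 0].
  move/eqP: sq; rewrite !paddr_eq0 ?addr_ge0 ?sqr_ge0 // !sqrf_eq0.
  by move=> /andP[/andP[/eqP -> /eqP ->] /eqP ->].
rewrite z1 in b23; rewrite z2 in b13; rewrite z3 oppr0 in b12; rewrite oppr0 in b23.
have bC z v : b [lie z, v] = 0 -> b [lie v, z] = 0.
  by move=> zv; rewrite lieC (scalar_fN lb) zv oppr0.
move/eqP: bxy; apply; rewrite [x]expand [y]expand !lieE !cxi !liexi.
rewrite !(scalar_fD lb) !(scalar_fZ lb) !(scalar_f0 lb).
rewrite z1 z2 z3 b23 b13 b12 (bC _ _ z1) (bC _ _ z2) (bC _ _ z3) (bC _ _ b23) (bC _ _ b13) (bC _ _ b12).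
by ring.
Qed.

End Frame.
(** A frame whose first vector is the normalised gradient of the trace form. *)
Lemma trace_frame (t : L) : tau t != 0 -> exists e f r,
  [/\ phi_frame Phi alpha g e f, r != 0 & forall x, tau x = r * g x e].
Proof.
move=> t0; have [e [f fr]] := frame_exists sasaki dimL.
have ae := frame_al_e fr; have af := frame_al_f fr.
pose H := tau e *: e + tau (Phi e) *: Phi e + tau f *: f + tau (Phi f) *: Phi f.
have tauxi : tau xi = 0.
  by rewrite (tau_frame fr) !cxi !gE; ring.
have tauH x : tau x = g x H.
  rewrite {1}(frame_expand sasaki dimL x fr).
  by rewrite !(scalar_fD tau_linear) !(scalar_fZ tau_linear) tauxi !gE; ring.
have H0 : H != 0 by apply: contraNneq t0 => H0; rewrite tauH H0 gE.
have aH : al H = 0 by rewrite !(alphaD, alphaZ) !alP ae af; ring.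
have [r r0 [ar rr]] := normalize sasaki aH H0.
have [f' fr'] := frame_of_unit sasaki dimL ar rr.
exists (r *: H), f', r^-1; split=> //; first by rewrite invr_neq0.
by move=> x; rewrite (metricZr sasaki) mulKf // tauH.
Qed.

(** Outside the unimodular case the kernel of the trace form is an ideal [U],
    on which [ad e] induces a derivation with nonzero trace [T].  If the three
    brackets of a basis of [U / xi] were independent, this derivation would have
    trace [3 T - T] in the basis formed by these brackets. *)
Lemma solvable_of_trace (t : L) : tau t != 0 -> lie_solvable L.
Proof.
move=> /trace_frame[e [f [r [fr r0 tauE]]]].
have G := frame_gram sasaki fr.
have ge0 x y : g [lie x, y] e = 0.
  by apply: (mulfI r0); rewrite -tauE ltrace_ad_bracket mulr0.
have brE x y : [lie x, y] = al [lie x, y] *: xi + g [lie x, y] (Phi e) *: Phi e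
    + g [lie x, y] f *: f + g [lie x, y] (Phi f) *: Phi f.
  by rewrite {1}[[lie x, y]](frame_expand sasaki dimL _ fr) ge0; vring.
pose m1 := [lie f, Phi f]; pose m2 := [lie Phi f, Phi e]; pose m3 := [lie Phi e, f].
pose W := <<[:: xi; m1; m2; m3]>>%VS.
have mW z : z \in [:: xi; m1; m2; m3] -> z \in W by exact: memv_span.
have L2 : (lie_derived_series L 2 <= W)%VS.
  have L1 : (lie_derived_series L 1 <= <<[:: xi; Phi e; f; Phi f]>>)%VS.
    apply: lie_span_le => x y _ _; rewrite brE.
    by rewrite !memvD // memvZ // memv_span // !inE eqxx ?orbT.
  apply: subv_trans (lie_derived_series_mono L1) _; apply: lie_span_le => x y.
  have mem4 z : z \in <<[:: xi; Phi e; f; Phi f]>>%VS -> exists a b c d,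
      z = a *: xi + (b *: Phi e + (c *: f + d *: Phi f)).
    rewrite span_cons => /memv_addP[_ /vlineP[a ->] [w]].
    rewrite span_cons => /memv_addP[_ /vlineP[b ->] [_ /memv_span2[c [d ->]] ->]] ->.
    by exists a, b, c, d.
  move=> /mem4[a [b [c [d ->]]]] /mem4[a' [b' [c' [d' ->]]]].
  set z := [lie _, _].
  have -> : z = (c * d' - d * c') *: m1 + (d * b' - b * d') *: m2 + (b * c' - c * b') *: m3.
    rewrite /z !lieE !cxi !liexi [[lie f, Phi e]]lieC [[lie Phi f, f]]lieC.
    by rewrite [[lie Phi e, Phi f]]lieC -/m1 -/m2 -/m3; vring.
  by rewrite !memvD // memvZ // mW // !inE eqxx ?orbT.
have eW : e \notin W.
  apply/negP; rewrite /W span_cons => /memv_addP[_ /vlineP[a ->] [w]].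
  rewrite span_cons => /memv_addP[_ /vlineP[b ->] [_ /memv_span2[c [d ->]] ->]] E.
  have := congr1 (g^~ e) E; rewrite !gE G !ge0 (metric_xil sasaki) (frame_al_e fr).
  by rewrite !mulr0 !addr0 => /eqP; rewrite oner_eq0.
apply: (lie_solvable_of_dim3 (z := xi) (W := W) (k := 2)) => //.
  exact: (reeb_neq0 sasaki).
  by apply: mW; rewrite inE eqxx.
rewrite leqNgt; apply/negP => dW.
have dW4 : \dim W = 4%N.
  by apply/eqP; rewrite eqn_leq dW andbT; exact: (dim_span [:: xi; m1; m2; m3]).
pose X := [tuple e; xi; m1; m2; m3].
have freeX : free X by rewrite /= free_cons eW /free dW4.
have basisX : basis_of fullv X.
  by rewrite basisEfree freeX subvf dimL.
have TE : tau e = g [lie e, Phi e] (Phi e) + g [lie e, f] f + g [lie e, Phi f] (Phi f).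
  by rewrite (tau_frame fr) lie_alternating gE add0r.
have em1 : [lie e, m1] = (g [lie e, f] f + g [lie e, Phi f] (Phi f)) *: m1
    - g [lie e, f] (Phi e) *: m2 - g [lie e, Phi f] (Phi e) *: m3.
  rewrite [LHS]lie_leibniz [X in [lie X, _] + _]brE [X in _ + [lie _, X]]brE !lieE !cxi !liexi.
  by rewrite [[lie f, Phi e]]lieC [[lie Phi e, Phi f]]lieC -/m1 -/m2 -/m3; vring.
have em2 : [lie e, m2] = (g [lie e, Phi f] (Phi f) + g [lie e, Phi e] (Phi e)) *: m2
    - g [lie e, Phi f] f *: m3 - g [lie e, Phi e] f *: m1.
  rewrite [LHS]lie_leibniz [X in [lie X, _] + _]brE [X in _ + [lie _, X]]brE !lieE !cxi !liexi.
  by rewrite [[lie f, Phi e]]lieC [[lie Phi f, f]]lieC -/m1 -/m2 -/m3; vring.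
have em3 : [lie e, m3] = (g [lie e, Phi e] (Phi e) + g [lie e, f] f) *: m3
    - g [lie e, Phi e] (Phi f) *: m1 - g [lie e, f] (Phi f) *: m2.
  rewrite [LHS]lie_leibniz [X in [lie X, _] + _]brE [X in _ + [lie _, X]]brE !lieE !cxi !liexi.
  by rewrite [[lie Phi f, f]]lieC [[lie Phi e, Phi f]]lieC -/m1 -/m2 -/m3; vring.
have dual v : v = \sum_j coord X j v *: X`_j by apply: coord_basis basisX (memvf v).
have lin j : scalar (coord X j) by move=> k u v; rewrite linearP.
have coordX (i j : 'I_5) : coord X i X`_j = (i == j)%:R by rewrite coord_free // eq_sym.
have c1 i : coord X i m1 = (i == inord 2)%:R by rewrite -coordX inordK.
have c2 i : coord X i m2 = (i == inord 3)%:R by rewrite -coordX inordK.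
have c3 i : coord X i m3 = (i == inord 4)%:R by rewrite -coordX inordK.
have : tau e = 2 * tau e.
  rewrite {1}(ltrace_dual _ lin dual) !big_ord_recl big_ord0 /= !lie_adE.
  rewrite lie_alternating liexi em1 em2 em3 !(scalar_f0 (lin _)).
  rewrite !(scalar_fD (lin _)) !(scalar_fN (lin _)) !(scalar_fZ (lin _)) !c1 !c2 !c3.
  by rewrite -!val_eqE /= !inordK //= TE; ring.
have : tau e != 0 by rewrite tauE G mulr1.
by move=> te0 h; move/eqP: te0; apply; lra.
Qed.

Lemma central_reeb_solvable : lie_solvable L.
Proof.
have [e [f fr]] := frame_exists sasaki dimL.
pose tau0 i := tau (vbasis {:L})`_i == 0.
have [/forallP t0 | /forallPn[i ti]] := boolP [forall i : 'I_(\dim {:L}), tau0 i]; last first.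
  exact: solvable_of_trace ti.
apply: (lie_solvable_central_plane (k := 1) cxi (derived_sub_of_unimodular fr _)) => x.
rewrite (coord_vbasis (memvf x)).
elim/big_rec: _ => [|i y _ IH]; first exact: (scalar_f0 tau_linear).
by rewrite (scalar_fD tau_linear) (scalar_fZ tau_linear) IH (eqP (t0 i)) mulr0 addr0.
Qed.

End CentralReeb.

(** * The induced Kaehler structure *)

Section InducedKaehler.
Variables (R : realType) (L : lieAlgType R).
Variables (Phi : 'End(L)) (alpha : 'Hom(L, R^o)) (xi : L) (g : L -> L -> R).
Hypothesis sasaki : sasakian Phi alpha xi g.
Implicit Types (x y z : L).

Local Notation al x := (alpha x : R).
Let gE := metricE sasaki.
Let Phi2 := sasakian_sqr sasaki.
Let alP := alpha_Phi sasaki.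
Let alxi := sasakian_reeb sasaki.

Lemma center_line : lie_center L <> 0%VS -> lie_center L = <[xi]>%VS.
Proof.
move=> c0; have z0 : vpick (lie_center L) != 0 by rewrite vpick0; apply/eqP.
have xic : xi \in lie_center L.
  move: (memv_pick (lie_center L)) z0; move: (vpick _) => z zc.
  rewrite (center_sub_xi sasaki zc) scaler_eq0 negb_or => /andP[a0 _].
  by rewrite -[xi](scalerK a0) memvZ // -(center_sub_xi sasaki zc).
apply/vspaceP => x; apply/idP/idP => [/(center_sub_xi sasaki) -> |]; first by rewrite memvZ ?memv_line.
by move=> /vlineP[a ->]; rewrite memvZ.
Qed.

Hypothesis centerE : lie_center L = <[xi]>%VS.

Let cxi x : [lie xi, x] = 0.
Proof. by have /lie_centerP : xi \in lie_center L by rewrite centerE memv_line. Qed.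

Local Notation Q := (lie_quot (lie_center_ideal L)).
Local Notation D := (subvs_of (lker alpha)).
Local Notation pr := (lie_quot_proj (lie_center_ideal L)).

Lemma quot_proj_eq x y : pr x = pr y <-> exists a, x = y + a *: xi.
Proof.
split=> [/lie_quot_projP | [a ->]].
  by rewrite /= centerE => /vlineP[a xy]; exists a; rewrite -xy addrC subrK.
by apply/lie_quot_projP; rewrite /= addrAC subrr add0r centerE memvZ // memv_line.
Qed.

Lemma quot_proj_surj (q : Q) : exists x, q = pr x.
Proof. by exists (repr (q : vquot _)); rewrite lfunE; apply/esym/vpi_repr. Qed.

Let horiz x : x - al x *: xi \in lker alpha.
Proof.
by rewrite memv_ker; apply/eqP; change (al (x - al x *: xi) = 0); rewrite alphaD alphaN alphaZ alxi; ring.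
Qed.

Let hor x : D := Subvs (horiz x).

Let ker_to_quotE (d : D) : ker_to_quot alpha d = pr (vsval d).
Proof. by rewrite /ker_to_quot comp_lfunE; congr (pr _); rewrite lfunE. Qed.

Let pr_hor x : ker_to_quot alpha (hor x) = pr x.
Proof.
rewrite ker_to_quotE; apply/quot_proj_eq; exists (- al x).
by rewrite scaleNr.
Qed.

Lemma ker_to_quot_bij : bijective (ker_to_quot alpha).
Proof.
have inj : injective (ker_to_quot alpha).
  move=> d d'; rewrite !ker_to_quotE => /quot_proj_eq[a E].
  apply: val_inj; rewrite /= E.
  have kd (u : D) : al (vsval u) = 0 by have := subvsP u; rewrite memv_ker => /eqP.
  have := congr1 (fun x => al x) E; rewrite /= alphaD alphaZ alxi !kd add0r mulr1 => <-.
  by rewrite scale0r addr0.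
have ker0 : lker (ker_to_quot alpha) == 0%VS.
  apply/eqP/vspaceP => d; rewrite memv_ker memv0; apply/eqP/eqP => [|->]; last exact: linear0.
  by move=> d0; apply: inj; rewrite d0 linear0.
exists ((ker_to_quot alpha)^-1)%VF; first exact: lker0_lfunK.
move=> q; have [x ->] := quot_proj_surj q.
by rewrite -pr_hor lker0_lfunK.
Qed.

Let inv_pr x : ((ker_to_quot alpha)^-1)%VF (pr x) = hor x.
Proof.
rewrite -pr_hor lker0_lfunK //.
apply/eqP/vspaceP => d; rewrite memv_ker memv0; apply/eqP/eqP => [|->]; last exact: linear0.
by move=> d0; apply: (bij_inj ker_to_quot_bij); rewrite d0 linear0.
Qed.

Lemma Phi_preserves_ker : (Phi @: lker alpha <= lker alpha)%VS.
Proof.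
apply/subvP => _ /memv_imgP[x _ ->]; rewrite memv_ker; apply/eqP; exact: alP.
Qed.

Lemma induced_PhiE x : induced_Phi Phi alpha (pr x) = pr (Phi x).
Proof.
have restrE (d : D) : vsval (ker_restr Phi alpha d) = Phi (vsval d).
  have lin : linear (fun x : D => vsproj (lker alpha) (Phi (vsval x))).
    by move=> a u v; rewrite !linearP.
  pose F : {linear D -> D} := HB.pack (fun x : D => vsproj (lker alpha) (Phi (vsval x)))
    (GRing.isLinear.Build _ _ _ _ _ lin).
  have -> : ker_restr Phi alpha d = F d by rewrite /ker_restr (lfunE F).
  by rewrite vsprojK // memv_ker; apply/eqP; exact: alP.
rewrite /induced_Phi comp_lfunE comp_lfunE inv_pr ker_to_quotE restrE.
by congr (pr _); rewrite linearB linearZ /= (Phi_xi sasaki) scaler0 subr0.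
Qed.

Lemma induced_metricE x y : induced_metric alpha g (pr x) (pr y) = g x y - al x * al y.
Proof.
rewrite /induced_metric !inv_pr /= !gE (metric_xi sasaki) !(metric_xil sasaki) alxi; ring.
Qed.

(** Through the projection from the whole algebra, the induced endomorphism is
    [Phi], and the induced fundamental form is [g x (Phi y) = d alpha x y / 2],
    whose closedness is the Jacobi identity. *)
Lemma induced_kaehler : kaehler (induced_Phi Phi alpha) (induced_metric alpha g).
Proof.
split.
- move=> q; have [x ->] := quot_proj_surj q; rewrite !induced_PhiE Phi2 linearD linearN /=.
  rewrite -[RHS]addr0; congr (_ + _); rewrite -(linear0 pr); apply/quot_proj_eq.
  by exists (al x); rewrite add0r.
- move=> p q; have [x ->] := quot_proj_surj p; have [y ->] := quot_proj_surj q.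
  rewrite /nijenhuis !(induced_PhiE x) !(induced_PhiE y) -!lie_quot_proj_hom !induced_PhiE.
  transitivity (pr (nijenhuis Phi x y)); first by rewrite /nijenhuis 2!linearB linearD.
  rewrite (sasakian_normal sasaki x y) -(linear0 pr); apply/quot_proj_eq.
  by exists (- lie_d1 alpha x y); rewrite add0r [RHS]scaleNr.
- split.
  + move=> r a p q; have [z ->] := quot_proj_surj r.
    have [x ->] := quot_proj_surj p; have [y ->] := quot_proj_surj q.
    by rewrite /= -linearP !induced_metricE !gE alphaD alphaZ; ring.
  + move=> p q; have [x ->] := quot_proj_surj p; have [y ->] := quot_proj_surj q.
    by rewrite !induced_metricE (metricC sasaki x); ring.
  + move=> q; have [x ->] := quot_proj_surj q => q0; rewrite /induced_metric inv_pr.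
    apply: (metric_gt0 sasaki); apply: contraNneq q0 => h0.
    by apply/eqP; rewrite -pr_hor; have -> : hor x = 0; [exact: val_inj | rewrite linear0].
- move=> p q; have [x ->] := quot_proj_surj p; have [y ->] := quot_proj_surj q.
  by rewrite !induced_PhiE !induced_metricE !alP (sasakian_compat sasaki); ring.
move=> p q r; have [x ->] := quot_proj_surj p; have [y ->] := quot_proj_surj q.
have [z ->] := quot_proj_surj r; rewrite -!lie_quot_proj_hom !induced_PhiE !induced_metricE.
have := metric_Phi_cocycle sasaki x y z; rewrite !alP => h; lra.
Qed.

Lemma induced_kaehler_structure : has_induced_kaehler Phi alpha xi g.
Proof.
split; [exact: centerE | exact: Phi_preserves_ker | exact: ker_to_quot_bij |].
exact: induced_kaehler.
Qed.

End InducedKaehler.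

(** * The classification *)

Theorem mainTheorem1 (R : realType) (L : lieAlgType R)
    (Phi : 'End(L)) (alpha : 'Hom(L, R^o)) (xi : L) (g : L -> L -> R)
    (dimL : \dim {:L} = 5%N) (sasaki : sasakian Phi alpha xi g) :
  [/\ (lie_center L <> 0%VS ->
       [/\ lie_solvable L,
           \dim (lie_center L) = 1%N
         & has_induced_kaehler Phi alpha xi g]),
      (lie_center L = 0%VS ->
       [\/ lie_isomorphic L (sl2 R * aff R)%type,
           lie_isomorphic L (su2 R * aff R)%type
         | lie_isomorphic L (g0 R)])
    & [/\ lie_solvable (g0 R),
          ~ lie_unimodular (g0 R)
        & exists D : lie_action (abelian_lie 'rV[R]_2) (heis3 R),
            lie_isomorphic (g0 R) (semidirect D)]].
Proof.
split; last first.
- split; [exact: g0_solvable | exact: g0_not_unimodular |].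
  by exists (rotdil_action R); exact: g0_isomorphic_semidirect.
- move=> c0; have [e [f [m [fr De Df]]]] := reeb_eigenframe sasaki dimL.
  have m0 : m != 0.
    apply/eqP => m0; move/eqP: (reeb_neq0 sasaki); apply; apply/eqP.
    rewrite -memv0 -c0; apply/lie_centerP => x.
    rewrite (frame_expand sasaki dimL x fr) !lieE !(lie_xi_Phi sasaki) De Df m0.
    by rewrite !scale0r !linear0 !addr0.
  have [w [y [a nf]]] := reeb_normal_form_exists sasaki dimL fr m0 De Df.
  have [[a0 fh] | [a0 fh]] := rnf_fh nf.
  + have [mlt | mgt | mz] := ltrgtP m 0.
    * constructor 1; apply: (isomorphic_to_product dimL nf a0 fh (eps := -1)).
      - by rewrite mulrN1 oppr_gt0.
      - by rewrite sqrrN expr1n.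
      - exact: sl2_rotation_coords.
    * constructor 2; apply: (isomorphic_to_product dimL nf a0 fh (eps := 1)).
      - by rewrite mulr1.
      - by rewrite expr1n.
      - exact: su2_rotation_coords.
    * by rewrite mz eqxx in m0.
  + by constructor 3; apply: (isomorphic_to_g0 dimL m0 fh); rewrite -a0; exact: nf.
move=> c0; have cE := center_line sasaki c0.
have cxi x : [lie xi, x] = 0.
  by have /lie_centerP : xi \in lie_center L by rewrite cE memv_line.
split; first exact: (central_reeb_solvable sasaki dimL cxi).
  by rewrite cE dim_vline (reeb_neq0 sasaki).
exact: induced_kaehler_structure.
Qed.
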